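(* For every $n, k \in \mathbb{N}$, every finite alphabet $\Sigma$, and every $\gamma > 0$, there exists a $\gamma$-PRG $\mathsf{Gen}: \{0,1\}^s \to \{0,1\}^{nk}$ for $(k, n, \Sigma)$ block decision trees with seed length \[ s \le n + O(k\log|\Sigma| + (\log k)\log(1/\gamma)). \] The PRG can be computed in $\mathrm{poly}(n, k, \log|\Sigma|, \log(1/\gamma))$ time.
   Context: A $(k,n,\Sigma)$ block decision tree is a rooted tree of height $k$ in which every node $v$ at depth $<k$ has exactly $|\Sigma|$ children, labeled by the symbols of $\Sigma$, and an associated function $v:\{0,1\}^n\to\Sigma$; it defines $T:(\{0,1\}^n)^{\le k}\to V$ by $T(\text{empty}) =$ root and, if $T(X_1,\dots,X_{i-1}) = v$, then $T(X_1,\dots,X_i)$ is the child of $v$ labeled $v(X_i)$ (strings in $\{0,1\}^{nk}$ are read as $k$ blocks of $n$ bits). $U_m$ denotes the uniform distribution on $\{0,1\}^m$. $\mathsf{Gen}:\{0,1\}^s\to\{0,1\}^{nk}$ is a $\gamma$-PRG for $(k,n,\Sigma)$ block decision trees if for every such tree $T$, the distributions $T(\mathsf{Gen}(U_s))$ and $T(U_{nk})$ have total variation distance at most $\gamma$. *)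

(* Defs.v *)
From mathcomp Require Import all_boot all_order all_algebra.
From mathcomp Require Import reals exp.

Set Implicit Arguments.
Unset Strict Implicit.
Unset Printing Implicit Defensive.

Import Order.TTheory GRing.Theory Num.Theory.
Local Open Scope ring_scope.

Notation bits n := (n.-tuple bool).

(** * Block decision trees *)

(* [block_tree n Sigma h]: trees of height exactly [h].  The children of a node
   are indexed by their labels, so every internal node has exactly one child
   for each symbol of [Sigma]. *)
Inductive block_tree (n : nat) (Sigma : Type) : nat -> Type :=
| Leaf : block_tree n Sigma 0
| Node h : (bits n -> Sigma) -> (Sigma -> block_tree n Sigma h) ->
           block_tree n Sigma h.+1.

(* A vertex is identified with the sequence of labels on the path from the
   root to it; the vertex set of a tree of height [h] is thus [h.-bseq Sigma],
   the sequences of length at most [h], and the root is the empty sequence. *)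
Fixpoint tree_walk n (Sigma : Type) h (T : block_tree n Sigma h)
    (Xs : seq (bits n)) : seq Sigma :=
  match T, Xs with
  | Node _ v child, X :: Xs' => v X :: tree_walk (child (v X)) Xs'
  | _, _ => [::]
  end.

Lemma size_tree_walk n (Sigma : Type) h (T : block_tree n Sigma h) Xs :
  (size (tree_walk T Xs) <= h)%N.
Proof. by elim: T Xs => [|h' v child IH] [|X Xs] //=; apply: IH. Qed.

Definition tree_eval n (Sigma : Type) h (T : block_tree n Sigma h)
    (Xs : h.-bseq (bits n)) : h.-bseq Sigma :=
  Bseq (size_tree_walk T Xs).

Definition block n k (x : bits (n * k)) (i : nat) : bits n :=
  [tuple nth false x (i * n + j) | j < n].

Definition blocks n k (x : bits (n * k)) : k.-tuple (bits n) :=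
  [tuple block x i | i < k].

(** * Distributions and pseudorandom generators *)

Definition law (R : realType) (A B : finType) (f : A -> B) (b : B) : R :=
  #|[set a | f a == b]|%:R / #|A|%:R.

Definition tv_dist (R : realType) (B : finType) (p q : B -> R) : R :=
  (\sum_(b : B) `|p b - q b|) / 2.

Definition block_prg (R : realType) (gamma : R) (s n k : nat) (Sigma : finType)
    (Gen : bits s -> bits (n * k)) : Prop :=
  forall T : block_tree n Sigma k,
    tv_dist (law R (fun u : bits s => tree_eval T (blocks (Gen u))))
            (law R (fun x : bits (n * k) => tree_eval T (blocks x))) <= gamma.

(** * Logarithms *)

(* [ln] is 0 on nonpositive reals, so [log2 0 = 0]. *)
Definition log2 (R : realType) (x : R) : R := ln x / ln 2.

(* [log (1 / gamma)], read as 0 when [gamma >= 1]. *)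
Definition log2_inv (R : realType) (gamma : R) : R :=
  Num.max 0 (log2 gamma^-1).

(** * Deterministic multitape Turing machines *)

(* [None] is the blank symbol. *)
Notation cell := (option bool).

Variant direction := GoLeft | Stay | GoRight.

(* A two-way infinite tape: the cells to the left of the head, nearest first,
   and the cells from the head rightwards; all other cells are blank. *)
Record tape := Tape { tleft : seq cell; tright : seq cell }.

Definition tape_read (t : tape) : cell := head None (tright t).

Definition tape_act (t : tape) (a : cell * direction) : tape :=
  let r := a.1 :: behead (tright t) in
  match a.2 with
  | GoLeft => Tape (behead (tleft t)) (head None (tleft t) :: r)
  | Stay => Tape (tleft t) r
  | GoRight => Tape (a.1 :: tleft t) (behead (tright t))
  end.

Definition tape_of (w : seq bool) : tape := Tape [::] (map some w).

(* The word starting at the head and ending before the first blank. *)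
Fixpoint word_of (r : seq cell) : seq bool :=
  if r is Some b :: r' then b :: word_of r' else [::].

(* [tm_delta] returns [None] to halt. *)
Record turing_machine := TuringMachine {
  tm_tapes : nat;
  tm_out : 'I_tm_tapes;
  tm_state : finType;
  tm_start : tm_state;
  tm_delta : tm_state -> {ffun 'I_tm_tapes -> cell} ->
             option (tm_state * ('I_tm_tapes -> cell * direction))
}.

Definition tm_config (M : turing_machine) : Type :=
  (tm_state M * ('I_(tm_tapes M) -> tape))%type.

(* The [i]-th input word is written on tape [i]; other tapes are blank. *)
Definition tm_init (M : turing_machine) (ins : seq (seq bool)) : tm_config M :=
  (tm_start M, fun i : 'I_(tm_tapes M) => tape_of (nth [::] ins i)).

Definition tm_step (M : turing_machine) (c : tm_config M) :
    option (tm_config M) :=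
  if tm_delta c.1 [ffun i => tape_read (c.2 i)] is Some (q, a)
  then Some (q, fun i => tape_act (c.2 i) (a i)) else None.

Fixpoint tm_run (M : turing_machine) (t : nat) (c : tm_config M) :
    option (tm_config M) :=
  if tm_step c is Some c' then
    if t is t'.+1 then tm_run t' c' else None
  else Some c.

Definition tm_output (M : turing_machine) (c : tm_config M) : seq bool :=
  word_of (tright (c.2 (tm_out M))).

Definition tm_computes_in (M : turing_machine) (ins : seq (seq bool))
    (w : seq bool) (t : nat) : Prop :=
  exists2 c, tm_run t (tm_init M ins) = Some c & tm_output c = w.

(** * Input encodings *)

Definition unary (m : nat) : seq bool := nseq m true.

(* Binary expansion, least significant bit first; [up_log 2 m.+1] is the
   number of binary digits of [m]. *)
Definition binary (m : nat) : seq bool :=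
  mkseq (fun i => odd (m %/ 2 ^ i)) (up_log 2 m.+1).

(* A real number has no finite description; the machine receives the integer
   [ceil (1 / gamma)], which takes about [log (1 / gamma)] bits. *)
Definition prg_input (R : realType) (n k sigma : nat) (gamma : R)
    (u : seq bool) : seq (seq bool) :=
  [:: unary n; unary k; binary sigma; binary `|Num.ceil gamma^-1|%N; u].

(* Main.v *)
(** The generator is the Impagliazzo-Nisan-Wigderson recursion
    [gen (y, x) = gen x ++ gen (walk y x)], where [y] labels a walk from [x] in a
    constant-degree expander on bit strings.  A tree that has read the first half
    of the output remembers one of [|Sigma| ^ 2 ^ i] states, so a walk of length
    [O(2 ^ i log |Sigma| + log (1 / gamma) + log k)] makes the second half look
    fresh; summed over the [log k] levels this gives the seed length.

    The expander has all strings of any length [m] as vertices and five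
    involutions as edges: adding to every even (or odd) bit its left (or right)
    neighbour, and flipping the first bit.  On the Fourier side the additions act
    on the set of frequencies by transposition, and the position of the first 1 of
    a frequency is moved around by ping-pong: frequencies led by an odd position
    inject into half of those led by an even position, and conversely, except for
    those led by position 0, on which the flip acts as -1.  Hence no function of
    mean zero is almost invariant.  All operations are passes over a string, which
    makes the generator easy to run on a multitape machine using its tapes as
    stacks. *)

Require Import Defs.
From mathcomp Require Import all_boot all_order all_algebra.
From mathcomp Require Import reals exp.
From mathcomp Require Import zify ring lra.
From Stdlib Require Import FunctionalExtensionality.

Set Implicit Arguments.
Unset Strict Implicit.
Unset Printing Implicit Defensive.

Import Order.TTheory GRing.Theory Num.Theory.

Local Open Scope ring_scope.

(** * Expectation over uniform bit strings *)

(** The coefficient of [n] in the seed length is exactly 1, so the expander must have precisely the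
    strings of length [m] as vertices, for whatever [m] the recursion produces, with no rounding to
    a convenient size. A step of the walk spends five bits, one per involution, each deciding
    whether its involution is applied. Averaged over these bits, a step is a product of five
    orthogonal projections; it need not be self-adjoint, and only its contraction of the energy of
    mean-zero functions is used. The rate is tiny, which merely enlarges the constant number [K] of
    steps that halve the error. Errors double from one level of the recursion to the next, which is
    why [log k] joins [log (1 / gamma)] in the walk length. The machine needs hardly any arithmetic:
    [log |Sigma|], [log (1 / gamma)] and the height enter only as lengths of words, and the only
    number it counts with is the index of a block. *)

Fixpoint mean (R : realFieldType) (m : nat) (f : seq bool -> R) : R :=
  if m is m'.+1 then
    (mean m' (fun s => f (true :: s)) + mean m' (fun s => f (false :: s))) / 2
  else f [::].

Lemma eq_mean (R : realFieldType) m (f g : seq bool -> R) :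
  (forall s, size s = m -> f s = g s) -> mean m f = mean m g.
Proof.
elim: m f g => [|m IH] f g fg /=; first exact: fg.
by congr ((_ + _) / 2); apply: IH => s sm; apply: fg; rewrite /= sm.
Qed.

Lemma le_mean (R : realFieldType) m (f g : seq bool -> R) :
  (forall s, size s = m -> f s <= g s) -> mean m f <= mean m g.
Proof.
elim: m f g => [|m IH] f g fg /=; first exact: fg.
rewrite ler_pM2r ?invr_gt0 ?ltr0n // lerD // IH // => s sm;
  by apply: fg; rewrite /= sm.
Qed.

Lemma mean_const (R : realFieldType) m (a : R) : mean m (fun=> a) = a.
Proof. by elim: m => //= m ->; field. Qed.

Lemma meanD (R : realFieldType) m (f g : seq bool -> R) :
  mean m (fun s => f s + g s) = mean m f + mean m g.
Proof. by elim: m f g => //= m IH f g; rewrite !IH; field. Qed.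

Lemma meanZ (R : realFieldType) m (a : R) (f : seq bool -> R) :
  mean m (fun s => a * f s) = a * mean m f.
Proof. by elim: m f => //= m IH f; rewrite !IH; field. Qed.

Lemma meanN (R : realFieldType) m (f : seq bool -> R) :
  mean m (fun s => - f s) = - mean m f.
Proof. by elim: m f => //= m IH f; rewrite !IH; field. Qed.

Lemma meanB (R : realFieldType) m (f g : seq bool -> R) :
  mean m (fun s => f s - g s) = mean m f - mean m g.
Proof. by rewrite meanD meanN. Qed.

Lemma mean_sum (R : realFieldType) m (I : finType) (F : I -> seq bool -> R) :
  mean m (fun s => \sum_i F i s) = \sum_i mean m (F i).
Proof.
by elim: m F => //= m IH F; rewrite !IH -big_split /= mulr_suml.
Qed.

Lemma mean_ge0 (R : realFieldType) m (f : seq bool -> R) :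
  (forall s, size s = m -> 0 <= f s) -> 0 <= mean m f.
Proof. by move=> f0; rewrite -(mean_const m (0 : R)); apply: le_mean. Qed.

Lemma ler_norm_mean (R : realFieldType) m (f : seq bool -> R) (a : R) :
  (forall s, size s = m -> `|f s| <= a) -> `|mean m f| <= a.
Proof.
move=> fa; rewrite ler_norml -{1}(mean_const m (- a)) -{2}(mean_const m a).
by apply/andP; split; apply: le_mean => s /fa; rewrite ler_norml => /andP[].
Qed.

Lemma mean_addn (R : realFieldType) a b (f : seq bool -> R) :
  mean (a + b) f = mean a (fun y => mean b (fun x => f (y ++ x))).
Proof. by elim: a f => //= a IH f; rewrite !IH. Qed.

Lemma mean_exchange (R : realFieldType) a b (F : seq bool -> seq bool -> R) :
  mean a (fun y => mean b (fun x => F y x)) =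
  mean b (fun x => mean a (fun y => F y x)).
Proof.
elim: a F => //= a IH F; rewrite !IH -meanD mulrC -meanZ.
by apply: eq_mean => s _; rewrite mulrC.
Qed.

(** The bridge to counting over tuples, needed only for total variation; elsewhere bits are peeled
    off one at a time. *)
Lemma mean_tuple (R : realFieldType) m (f : seq bool -> R) :
  mean m f = (\sum_(x : bits m) f x) / (2 ^ m)%:R.
Proof.
elim: m f => [|m IH] f /=.
  rewrite (big_pred1 [tuple]) ?divr1 // => x.
  by apply/esym/eqP; exact: tuple0.
have -> : \sum_(x : bits m.+1) f x =
    \sum_(p : bool * bits m) f (p.1 :: p.2).
  rewrite (reindex (fun p : bool * bits m => [tuple of p.1 :: p.2])) //=.
  exists (fun x : bits m.+1 => (thead x, [tuple of behead x])) => [[b x] _|x _] /=.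
    by congr (_, _); apply: val_inj.
  by rewrite -tuple_eta.
rewrite -(pair_bigA _ (fun b (x : bits m) => f (b :: x))) big_bool /= !IH.
by rewrite expnS natrM invfM; field; rewrite pnatr_eq0 expn_eq0.
Qed.

(** * The involutions and their action *)

(** [p] marks the positions that change. It alternates, so a changed bit always receives an
    unchanged neighbour, which makes the map an involution. A missing neighbour counts as 0. *)
Fixpoint xor_next (p : bool) (s : seq bool) : seq bool :=
  if s is x :: s' then (x (+) (p && head false s')) :: xor_next (~~ p) s'
  else [::].

Fixpoint xor_prev (p prev : bool) (s : seq bool) : seq bool :=
  if s is x :: s' then (x (+) (p && prev)) :: xor_prev (~~ p) x s' else [::].

Definition flip_head (s : seq bool) : seq bool :=
  if s is x :: s' then ~~ x :: s' else [::].

Definition generators : seq (seq bool -> seq bool) :=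
  [:: xor_next false; xor_next true;
      xor_prev false false; xor_prev true false; flip_head].

Lemma size_xor_next p s : size (xor_next p s) = size s.
Proof. by elim: s p => //= x s IH p; rewrite IH. Qed.

Lemma size_xor_prev p b s : size (xor_prev p b s) = size s.
Proof. by elim: s p b => //= x s IH p b; rewrite IH. Qed.

Lemma size_flip_head s : size (flip_head s) = size s.
Proof. by case: s. Qed.

Lemma head_xor_next s : head false (xor_next false s) = head false s.
Proof. by case: s => //= x s; rewrite addbF. Qed.

Lemma xor_nextK p s : xor_next p (xor_next p s) = s.
Proof.
elim: s p => //= x s IH p; rewrite IH; congr (_ :: _).
by case: p => /=; rewrite ?head_xor_next ?addbF // addbK.
Qed.

Lemma xor_prev_false a b s : xor_prev false a s = xor_prev false b s.
Proof. by case: s. Qed.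

Lemma xor_prevK p b s : xor_prev p b (xor_prev p b s) = s.
Proof.
elim: s p b => //= x s IH p b; case: p => /=; last by rewrite !addbF IH.
by rewrite (xor_prev_false _ x) IH addbK.
Qed.

Lemma flip_headK s : flip_head (flip_head s) = s.
Proof. by case: s => //= x s; rewrite negbK. Qed.

Definition measure_preserving (g : seq bool -> seq bool) : Prop :=
  forall (R : realFieldType) m (f : seq bool -> R),
    mean m (fun s => f (g s)) = mean m f.

(** For each tail, the bit [c s] at most swaps the two values of the first bit, so their sum is
    unaffected. *)
Lemma mean_xorb (R : realFieldType) m (c : seq bool -> bool)
    (F : bool -> seq bool -> R) :
  (mean m (fun s => F (true (+) c s) s) + mean m (fun s => F (false (+) c s) s))
    = mean m (F true) + mean m (F false).
Proof.
rewrite -!meanD; apply: eq_mean => s _; case: (c s) => //=; exact: addrC.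
Qed.

Lemma xor_next_mp p : measure_preserving (xor_next p).
Proof.
move=> R m f; elim: m p f => //= m IH p f; congr (_ / 2).
rewrite (mean_xorb m (fun s => p && head false s)
   (fun b s => f (b :: xor_next (~~ p) s))).
by rewrite !(IH _ (fun s => f (_ :: s))).
Qed.

Lemma xor_prev_mp p b : measure_preserving (xor_prev p b).
Proof.
move=> R m f; elim: m p b f => //= m IH p b f; congr (_ / 2).
rewrite !(IH _ _ (fun s => f (_ :: s))).
exact: (mean_xorb m (fun=> p && b) (fun b s => f (b :: s))).
Qed.

Lemma flip_head_mp : measure_preserving flip_head.
Proof. by move=> R [//|m] f /=; congr (_ / 2); exact: addrC. Qed.

(** * Fourier transform on bit strings *)

Fixpoint dot (x y : seq bool) : bool :=
  match x, y with
  | a :: x', b :: y' => (a && b) (+) dot x' y'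
  | _, _ => false
  end.

(** Transposition: adding bit [i + 1] to bit [i] is adjoint to adding bit [i] to bit [i + 1], so
    both the direction and the parity of the changed positions are exchanged. The generalisation
    over [prev] carries the term pairing the bit before [t] with the head of [s]. *)
Lemma dot_xor_next p s t : size s = size t ->
  dot (xor_next p s) t = dot s (xor_prev (~~ p) false t).
Proof.
suff gen prev : size s = size t ->
  dot s (xor_prev (~~ p) prev t) =
  dot (xor_next p s) t (+) [&& ~~ p, prev & head false s].
  by move=> st; rewrite (gen false st) andbF addbF.
elim: s t p prev => [|x s IH] [|y t] p prev //=; first by rewrite !andbF.
case=> st; rewrite -{1}(negbK p) IH // negbK.
by move: x y p prev (head false s) (dot _ _) => [] [] [] [] [] [].
Qed.

Lemma dot_xor_prev p s t : size s = size t ->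
  dot (xor_prev p false s) t = dot s (xor_next (~~ p) t).
Proof.
move=> st.
have sym x y : dot x y = dot y x.
  by elim: x y => [|a x IH] [|b y] //=; rewrite IH andbC.
by rewrite sym -{1}(negbK p) -dot_xor_next // sym.
Qed.

Definition hat (R : realFieldType) m (f : seq bool -> R) (y : seq bool) : R :=
  mean m (fun x => (-1) ^+ dot x y * f x).

Definition energy (R : realFieldType) m (f : seq bool -> R) : R :=
  mean m (fun s => f s ^+ 2).

Lemma energy_ge0 (R : realFieldType) m (f : seq bool -> R) : 0 <= energy m f.
Proof. by apply: mean_ge0 => s _; apply: sqr_ge0. Qed.

Lemma eq_energy (R : realFieldType) m (f g : seq bool -> R) :
  (forall s, size s = m -> f s = g s) -> energy m f = energy m g.
Proof. by move=> fg; apply: eq_mean => s sm; rewrite fg. Qed.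

Lemma energyZ (R : realFieldType) m a (f : seq bool -> R) :
  energy m (fun s => a * f s) = a ^+ 2 * energy m f.
Proof. by rewrite /energy -meanZ; apply: eq_mean => s _; rewrite exprMn. Qed.

(** Parseval. [hat] is normalised as an average, so the squared coefficients sum to the energy;
    averaging them costs [2 ^ m]. *)
Lemma energy_hat (R : realFieldType) m (f : seq bool -> R) :
  energy m (hat m f) = energy m f / (2 ^ m)%:R.
Proof.
rewrite /energy; elim: m f => [|m IH] f /=.
  by rewrite /hat /= expr0 mul1r divr1.
have hatS b y : hat m.+1 f (b :: y) =
    ((-1) ^+ b * hat m (fun s => f (true :: s)) y +
     hat m (fun s => f (false :: s)) y) / 2.
  rewrite /hat /= -meanZ; congr ((_ + _) / 2); apply: eq_mean => s _.
  by rewrite mulrA -signr_addb.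
rewrite -meanD.
rewrite (eq_mean (g := fun y => 2^-1 * ((hat m (fun s => f (true :: s)) y) ^+ 2 +
     (hat m (fun s => f (false :: s)) y) ^+ 2))); last first.
  by move=> s _; rewrite !hatS /= expr1 expr0; field.
rewrite meanZ meanD !IH expnS natrM invfM; field.
by rewrite pnatr_eq0 expn_eq0.
Qed.

(** The substitution of [g s] for [s] moves [g] onto the character, and adjointness moves it to the
    frequency. *)
Lemma hat_comp (R : realFieldType) m (f : seq bool -> R) g g' y :
  measure_preserving g -> (forall s, g (g s) = s) ->
  (forall s t, size s = m -> size t = m -> dot (g s) t = dot s (g' t)) ->
  size y = m -> hat m (fun s => f (g s)) y = hat m f (g' y).
Proof.
move=> gmp gK adj ym; rewrite /hat.
rewrite -(gmp _ _ (fun x => _ * f (g x))); apply: eq_mean => s sm.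
by rewrite gK adj.
Qed.

Lemma hatB (R : realFieldType) m (f g : seq bool -> R) y :
  hat m (fun s => f s - g s) y = hat m f y - hat m g y.
Proof. by rewrite /hat -meanB; apply: eq_mean => s _; rewrite mulrBr. Qed.

(** The flip is a translation, hence diagonal on characters. *)
Lemma hat_flip_head (R : realFieldType) m (f : seq bool -> R) y : size y = m ->
  hat m (fun s => f (flip_head s)) y = (-1) ^+ head false y * hat m f y.
Proof.
move=> ym; rewrite {1}/hat -(flip_head_mp _ (fun x => _ * f (flip_head x))).
rewrite /hat -meanZ; apply: eq_mean => s sm; rewrite flip_headK mulrA -signr_addb.
case: s y sm ym => [|x s] [|z y] //= sm; rewrite -?sm // => _.
by case: x z => [] [] //=; rewrite negbK.
Qed.

Lemma hat0 (R : realFieldType) m (f : seq bool -> R) :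
  hat m f (nseq m false) = mean m f.
Proof.
rewrite /hat; apply: eq_mean => s _; suff -> : dot s (nseq m false) = false by rewrite mul1r.
by elim: s m => [|x s IH] [|m] //=; rewrite IH andbF.
Qed.

(** * Spectral gap *)

Definition displacement (R : realFieldType) m (g : seq bool -> seq bool)
    (f : seq bool -> R) : R :=
  energy m (fun s => f (g s) - f s).

Definition mass (R : realFieldType) m (S : pred (seq bool)) (f : seq bool -> R) : R :=
  mean m (fun s => if S s then f s ^+ 2 else 0).

(* [lead q s]: [s] has a 1 and its first 1 is at an even position iff [q]; in
   [lead_next c q s], moreover, the next entry exists (if [c]) and equals [c]. *)
Fixpoint lead (q : bool) (s : seq bool) : bool :=
  if s is x :: s' then if x then q else lead (~~ q) s' else false.

Fixpoint lead_next (c q : bool) (s : seq bool) : bool :=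
  if s is x :: s' then if x then q && (head false s' == c)
                       else lead_next c (~~ q) s'
  else false.

(** The first 1 is copied onto its left neighbour and stays in place, becoming the entry after the
    new first 1. The hypothesis on the head guarantees a left neighbour. *)
Lemma lead_xor_next p s : head false s = false -> lead (~~ p) s ->
  lead_next true p (xor_next p s).
Proof.
elim: s p => //= x s IH p xF; rewrite xF /= => ls.
case sh : (head false s); last first.
  by rewrite andbF; apply: IH => //; rewrite negbK in ls *.
case: s ls sh {IH} => //= y s + yT; rewrite yT /= negbK => ->.
by [].
Qed.

(** The entry after the first 1 receives that 1 and becomes 0; the zeros in front receive only
    zeros. *)
Lemma lead_xor_prev p s : lead_next true p s ->
  lead_next false p (xor_prev (~~ p) false s).
Proof.
elim: s p => //= -[] s IH p /=; rewrite andbF /=; last by move=> ls; rewrite IH.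
by rewrite negbK => /andP[-> ]; case: s {IH} => //= x s /eqP->.
Qed.

Lemma lead_split p s : lead p s = lead_next true p s || lead_next false p s.
Proof.
by elim: s p => //= -[] s IH p //; case: p => //=; case: (head _ _).
Qed.

Lemma lead_next_excl p s : lead_next true p s && lead_next false p s = false.
Proof.
by elim: s p => //= -[] s IH p //; case: p => //=; case: (head _ _).
Qed.

Lemma lead_cases s : [|| s == nseq (size s) false, lead true s | lead false s].
Proof.
by elim: s => //= -[] s //= IH; rewrite eqseq_cons eqxx (orbC (lead false s)).
Qed.

Lemma lead_excl p s : lead p s && lead (~~ p) s = false.
Proof. by elim: s p => //= -[] s IH p //; rewrite andbN. Qed.

(** With d = f (g s) - f s, the quantity f (g s)^2 - 9/10 f(s)^2 + 9 d^2 is the square (f s + 10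
    d)^2 / 10. The fraction 9/10 is chosen so that a + a^2 > 1 holds for a = 9/10, as the ping-pong
    requires. *)
Lemma mass_transfer (R : realFieldType) m g (S S' : pred (seq bool))
    (f : seq bool -> R) :
  measure_preserving g ->
  (forall s, size s = m -> S s -> S' (g s)) ->
  9 / 10 * mass m S f - 10 * displacement m g f <= mass m S' f.
Proof.
move=> gmp SS'.
rewrite /mass -(gmp _ _ (fun s => if S' s then _ else _)) /displacement /energy.
rewrite -!meanZ -meanB; apply: le_mean => s sm.
case: ifP => [/(SS' _ sm) ->|_].
  have := sqr_ge0 (f s + 10 * (f (g s) - f s)).
  have := sqr_ge0 (f (g s) - f s); lra.
have := sqr_ge0 (f (g s) - f s); have := sqr_ge0 (f (g s)).
by case: ifP => _; lra.
Qed.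

Lemma mass_lead (R : realFieldType) m p (f : seq bool -> R) :
  mass m (lead p) f = mass m (lead_next true p) f + mass m (lead_next false p) f.
Proof.
rewrite /mass -meanD; apply: eq_mean => s _; rewrite lead_split.
move: (lead_next_excl p s).
by case: (lead_next true p s) (lead_next false p s) => [] [] //= _;
  rewrite ?addr0 ?add0r.
Qed.

Lemma mass_ge0 (R : realFieldType) m S (f : seq bool -> R) : 0 <= mass m S f.
Proof. by apply: mean_ge0 => s _; case: ifP => // _; apply: sqr_ge0. Qed.

(* An addition sends [lead (~~ p)] into [lead_next true p], and another one swaps
   [lead_next true p] and [lead_next false p]; for a nearly invariant [f], the mass
   of [lead p] is thus about twice that of [lead (~~ p)], for both values of [p]. *)
Lemma dual_gap (R : realFieldType) m (f : seq bool -> R) :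
  f (nseq m false) = 0 ->
  energy m f <= 100 * (mass m (head false) f +
    \sum_(p : bool) (displacement m (xor_next p) f +
                     displacement m (xor_prev p false) f)).
Proof.
move=> f0.
have even1 : 9 / 10 * mass m (lead false) f - 10 * displacement m (xor_next true) f
    <= mass m (lead_next true true) f.
  apply: mass_transfer (@xor_next_mp true) _ => -[|[] s] _ // ls.
  exact: (@lead_xor_next true).
have even0 : 9 / 10 * mass m (lead_next true true) f
      - 10 * displacement m (xor_prev false false) f
    <= mass m (lead_next false true) f.
  apply: mass_transfer (@xor_prev_mp false false) _ => s _.
  exact: (@lead_xor_prev true).
have odd1 : 9 / 10 * mass m [pred s | lead true s & ~~ head false s] f
      - 10 * displacement m (xor_next false) f
    <= mass m (lead_next true false) f.
  apply: mass_transfer (@xor_next_mp false) _ => s _ /andP[ls /negbTE hs].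
  exact: (@lead_xor_next false).
have odd0 : 9 / 10 * mass m (lead_next true false) f
      - 10 * displacement m (xor_prev true false) f
    <= mass m (lead_next false false) f.
  apply: mass_transfer (@xor_prev_mp true false) _ => s _.
  exact: (@lead_xor_prev false).
have splitE : energy m f = mass m (lead true) f + mass m (lead false) f.
  rewrite /energy /mass -meanD; apply: eq_mean => s sm.
  move: (lead_excl true s) (lead_cases s); rewrite sm.
  do 2 case: ifP => // _; rewrite ?addr0 ?add0r //= orbF => _ /eqP ->.
  by rewrite f0 expr0n.
have splitB : mass m (lead true) f =
    mass m (head false) f + mass m [pred s | lead true s & ~~ head false s] f.
  rewrite /mass -meanD; apply: eq_mean => -[|[] s] _ /=;
    by rewrite ?addr0 ?add0r ?andbT.
(* Up to displacements, and since 9/10 + (9/10)^2 = 1.71, the mass of [lead true] is at least 1.71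
   times that of [lead false], itself at least 1.71 times the mass of [lead true] outside
   [head false]. Hence everything is bounded by the mass of [head false]. *)
rewrite big_bool /= splitE.
have := mass_lead m true f; have := mass_lead m false f.
have := mass_ge0 m (head false) f.
have dg g := energy_ge0 m (fun s => f (g s) - f s).
have := dg (xor_next true); have := dg (xor_next false).
have := dg (xor_prev true false); have := dg (xor_prev false false).
rewrite -!/(displacement _ _ _); lra.
Qed.

(** * Averaging over the involutions *)

Definition avg_with (R : realFieldType) (g : seq bool -> seq bool)
    (f : seq bool -> R) (x : seq bool) : R := (f x + f (g x)) / 2.

Lemma mean_avg_with (R : realFieldType) m g (f : seq bool -> R) :
  measure_preserving g -> mean m (avg_with g f) = mean m f.
Proof.
move=> gmp; rewrite (eq_mean (g := fun s => 2^-1 * (f s + f (g s)))); last first.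
  by move=> s _; rewrite mulrC.
by rewrite meanZ meanD gmp; field.
Qed.

(** The parallelogram law; for an involution, Pythagoras for the projection onto invariant
    functions. *)
Lemma energy_avg_with (R : realFieldType) m g (f : seq bool -> R) :
  measure_preserving g ->
  energy m f = energy m (avg_with g f) + displacement m g f / 4.
Proof.
move=> gmp.
have -> : displacement m g f / 4 = mean m (fun s => (f (g s) - f s) ^+ 2 / 4).
  by rewrite mulrC -meanZ; apply: eq_mean => s _; rewrite mulrC.
have {1}-> : energy m f = 2^-1 * (energy m f + energy m (fun s => f (g s))).
  have -> : energy m (fun s => f (g s)) = energy m f := gmp _ _ (fun s => f s ^+ 2).
  by field.
rewrite /energy -!meanD -meanZ.
by apply: eq_mean => s _; rewrite /avg_with; field.
Qed.

Lemma energyD (R : realFieldType) m (f g : seq bool -> R) :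
  energy m (fun s => f s + g s) <= 2 * (energy m f + energy m g).
Proof.
rewrite /energy -meanD -meanZ; apply: le_mean => s _.
by have := sqr_ge0 (f s - g s); lra.
Qed.

(* Averaging over an involution is an orthogonal projection, so the energy lost
   by a composite of such projections controls each displacement. *)
Lemma displacement_le (R : realFieldType) m (gs : seq (seq bool -> seq bool))
    (f : seq bool -> R) :
  (forall i, measure_preserving (nth id gs i)) ->
  let f' := foldr (@avg_with R) f gs in
  [/\ energy m (fun s => f s - f' s) <= (2 ^ size gs)%:R * (energy m f - energy m f'),
      energy m f' <= energy m f &
      forall i, (i < size gs)%N ->
        displacement m (nth id gs i) f
        <= 12 * (2 ^ size gs)%:R * (energy m f - energy m f')].
Proof.
elim: gs => [|g gs IH] gmp /=.
  split=> //; rewrite subrr mulr0 (eq_energy (g := fun=> 0 * 0)) ?energyZ ?expr0n ?mul0r //.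
  by move=> s _; rewrite subrr.
have g0 := gmp 0; case: {IH}(IH (fun i => gmp i.+1)) => /=.
set f1 := foldr _ _ _ => I1 I2 I3.
have E1 := energy_avg_with m f1 g0.
have dg0 := energy_ge0 m (fun s => f1 (g s) - f1 s).
rewrite -/(displacement _ _ _) in dg0.
have p0 : 1 <= (2 ^ size gs)%:R :> R by rewrite ler1n expn_gt0.
rewrite expnS natrM; set p := (2 ^ size gs)%:R : R in I1 I3 p0 *.
have E2 : energy m (fun s => f1 s - avg_with g f1 s) = displacement m g f1 / 4.
  rewrite (eq_energy (g := fun s => - 2^-1 * (f1 (g s) - f1 s))).
    by rewrite energyZ /displacement; field.
  by move=> s _; rewrite /avg_with; field.
split; [| lra |].
- have -> : energy m (fun s => f s - avg_with g f1 s) =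
    energy m (fun s => (f s - f1 s) + (f1 s - avg_with g f1 s)).
    by apply: eq_energy => s _; rewrite addrA subrK.
  have := energyD m (fun s => f s - f1 s) (fun s => f1 s - avg_with g f1 s).
  by nra.
case=> [_|i ltin] /=; last by have := I3 i ltin; nra.
(* Triangle inequality through [f1]: with I the energy of [f - f1] and D the displacement of [f1],
   the bound is 2 I + 4 (D + I), and D is 4 times the energy lost by the last average. *)
have -> : displacement m g f = energy m (fun s => (f (g s) - f1 (g s)) +
   ((f1 (g s) - f1 s) + - 1 * (f s - f1 s))).
  by apply: eq_energy => s _; ring.
have := energyD m (fun s => f (g s) - f1 (g s))
   (fun s => (f1 (g s) - f1 s) + - 1 * (f s - f1 s)).
have := energyD m (fun s => f1 (g s) - f1 s) (fun s => - 1 * (f s - f1 s)).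
rewrite energyZ -/(displacement m g f1).
have -> : energy m (fun s => f (g s) - f1 (g s)) = energy m (fun s => f s - f1 s).
  exact: (g0 _ _ (fun s => (f s - f1 s) ^+ 2)).
by nra.
Qed.

Lemma generators_mp i : measure_preserving (nth id generators i).
Proof.
case: i => [|[|[|[|[|i]]]]] /=.
- exact: xor_next_mp.
- exact: xor_next_mp.
- exact: xor_prev_mp.
- exact: xor_prev_mp.
- exact: flip_head_mp.
- by rewrite nth_nil => R m f.
Qed.

Lemma displacement_hat (R : realFieldType) m (f : seq bool -> R) g g' :
  measure_preserving g -> (forall s, g (g s) = s) ->
  (forall s t, size s = m -> size t = m -> dot (g s) t = dot s (g' t)) ->
  displacement m g' (hat m f) = displacement m g f / (2 ^ m)%:R.
Proof.
move=> gmp gK adj; rewrite /displacement -energy_hat; apply: eq_energy => y ym.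
by rewrite hatB (hat_comp _ gmp gK adj).
Qed.

(** [dual_gap] applied to the Fourier transform: mean zero removes the frequency 0, and
    transposition permutes the four additions. *)
Lemma spectral_gap (R : realFieldType) m (f : seq bool -> R) : mean m f = 0 ->
  energy m f <= 100 * \sum_(g <- generators) displacement m g f.
Proof.
move=> f0; have := @dual_gap R m (hat m f); rewrite hat0 => /(_ f0).
have N0 : 0 < (2 ^ m)%:R^-1 :> R by rewrite invr_gt0 ltr0n expn_gt0.
rewrite energy_hat big_bool /=.
have dn p : displacement m (xor_next p) (hat m f) =
    displacement m (xor_prev (~~ p) false) f / (2 ^ m)%:R.
  apply: displacement_hat (@xor_prev_mp _ _) (xor_prevK _ _) _ => s t sm tm.
  by rewrite dot_xor_prev ?negbK // sm.
have dp p : displacement m (xor_prev p false) (hat m f) =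
    displacement m (xor_next (~~ p)) f / (2 ^ m)%:R.
  apply: displacement_hat (@xor_next_mp _) (xor_nextK _) _ => s t sm tm.
  by rewrite dot_xor_next ?negbK // sm.
rewrite !dn !dp /=.
(* The transform of [f \o flip_head - f] is -2 times that of [f] at frequencies starting with 1, and
   0 elsewhere; hence the 4. *)
have -> : mass m (head false) (hat m f) = displacement m flip_head f / 4 / (2 ^ m)%:R.
  rewrite mulrAC -energy_hat mulrC /energy -meanZ; apply: eq_mean => s sm.
  rewrite hatB hat_flip_head //.
  by case: (head _ _); rewrite ?expr1 ?expr0; field.
have := energy_ge0 m (fun s => f (flip_head s) - f s).
rewrite -/(displacement _ _ _) /generators.
rewrite !big_cons big_nil.
set N := (2 ^ m)%:R^-1 in N0 *; set e := energy m f.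
set a := displacement _ _ _; set b := displacement _ _ _; set c := displacement _ _ _.
set d := displacement _ _ _; set h := displacement _ _ _ => a0 H.
rewrite -(ler_pM2r N0); nra.
Qed.

Definition act (gs : seq (seq bool -> seq bool)) (y x : seq bool) : seq bool :=
  foldl (fun x p => if p.1 then p.2 x else x) x (zip y gs).

(** Each random bit applies or skips one involution, so a random label composes the averages. *)
Lemma mean_act (R : realFieldType) gs (f : seq bool -> R) x :
  mean (size gs) (fun y => f (act gs y x)) = foldr (@avg_with R) f gs x.
Proof.
elim: gs x => [//|g gs IH] x /=.
rewrite -[RHS]/((foldr (@avg_with R) f gs x + foldr (@avg_with R) f gs (g x)) / 2) -!IH.
congr (_ / 2).
exact: addrC.
Qed.

Definition averaged (R : realFieldType) (f : seq bool -> R) (x : seq bool) : R :=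
  mean 5 (fun y => f (act generators y x)).

Lemma mean_averaged (R : realFieldType) m (f : seq bool -> R) :
  mean m (averaged f) = mean m f.
Proof.
rewrite (eq_mean (g := foldr (@avg_with R) f generators)); last first.
  by move=> s _; apply: (@mean_act R generators).
have := generators_mp; elim: generators => //= g gs IH gmp.
by rewrite mean_avg_with; [apply: IH => i; apply: (gmp i.+1) | apply: (gmp 0)].
Qed.

(* 192000 = 100 * 5 * 12 * 2 ^ 5, from [spectral_gap] and [displacement_le]. *)
Lemma energy_averaged (R : realFieldType) m (f : seq bool -> R) : mean m f = 0 ->
  energy m (averaged f) <= (1 - (192 * 1000)^-1) * energy m f.
Proof.
move=> /spectral_gap gap; have [_ _ D] := displacement_le m f generators_mp.
rewrite (eq_energy (g := foldr (@avg_with R) f generators)); last first.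
  by move=> s _; apply: (@mean_act R generators).
have {}gap : energy m f <= 100 * \sum_(i < 5) displacement m (nth id generators i) f.
  by move: gap; rewrite (big_nth id) big_mkord.
have : \sum_(i < 5) displacement m (nth id generators i) f <=
    \sum_(i < 5) (12 * (2 ^ 5)%:R *
      (energy m f - energy m (foldr (@avg_with R) f generators))).
  by apply: ler_sum => i _; apply: D.
rewrite sumr_const card_ord -mulr_natl.
move: (energy m (foldr _ _ _)) (energy m f) gap => a b gap.
have -> : (2 ^ 5)%:R = 32%:R :> R by [].
lra.
Qed.

(** * Random walks and mixing *)

Fixpoint walk (r : nat) (y x : seq bool) : seq bool :=
  if r is r'.+1 then walk r' (drop 5 y) (act generators (take 5 y) x) else x.

Definition walk_avg (R : realFieldType) r (f : seq bool -> R) (x : seq bool) : R :=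
  mean (5 * r) (fun y => f (walk r y x)).

Lemma walk_avgS (R : realFieldType) r (f : seq bool -> R) x :
  walk_avg r.+1 f x = averaged (walk_avg r f) x.
Proof.
rewrite /walk_avg mulnS mean_addn; apply: eq_mean => y y5; apply: eq_mean => z _.
by rewrite /= drop_cat take_cat y5 ltnn subnn drop0 take0 cats0.
Qed.

Lemma mean_walk_avg (R : realFieldType) m r (f : seq bool -> R) :
  mean m (walk_avg r f) = mean m f.
Proof.
elim: r => [//|r IH]; rewrite -IH -[RHS]mean_averaged.
by apply: eq_mean => s _; apply: walk_avgS.
Qed.

Lemma energy_walk_avg (R : realFieldType) m r (f : seq bool -> R) : mean m f = 0 ->
  energy m (walk_avg r f) <= (1 - (192 * 1000)^-1) ^+ r * energy m f.
Proof.
move=> f0; elim: r => [|r IH]; first by rewrite expr0 mul1r lexx.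
rewrite (eq_energy (g := averaged (walk_avg r f))); last first.
  by move=> s _; apply: walk_avgS.
apply: le_trans (energy_averaged _) _; first by rewrite mean_walk_avg.
rewrite exprS -mulrA ler_pM2l //; lra.
Qed.

(** With e the gap and K = 3 / e, Bernoulli gives (1 + e)^K >= 4, while (1 - e)^K (1 + e)^K <= 1. *)
Lemma decay_rate (R : realFieldType) :
  exists K : nat, (1 - (192 * 1000)^-1 : R) ^+ K <= 1 / 4.
Proof.
set e : R := (192 * 1000)^-1.
have e0 : 0 < e by rewrite invr_gt0 mulr_gt0 // ltr0n.
have e1 : e < 1 by rewrite /e; lra.
have bern r : 1 + r%:R * e <= (1 + e) ^+ r.
  elim: r => [|r IH]; first by rewrite expr0 mul0r addr0.
  rewrite exprS -natr1; have r0 : 0 <= r%:R :> R := ler0n _ _; nra.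
have [K hK] : exists K : nat, K%:R * e = 3.
  have [a ha] : exists a : nat, a%:R = 192 :> R by exists 192%N.
  have [b hb] : exists b : nat, b%:R = 1000 :> R by exists 1000%N.
  by exists (3 * (a * b))%N; rewrite !natrM ha hb /e; field.
exists K; have := bern K; rewrite hK => b4.
have : (1 - e) ^+ K * (1 + e) ^+ K <= 1.
  by rewrite -exprMn exprn_ile1 //; nra.
have : 0 <= (1 - e) ^+ K by rewrite exprn_ge0 // subr_ge0 ltW.
move: ((1 - e) ^+ K) ((1 + e) ^+ K) b4 => a b; nra.
Qed.

(** Walking preserves the mean, so centring [g] leaves the correlation of a bounded [f] with a
    function whose energy has shrunk by (1/4)^q, the square of the claimed bound. *)
Lemma walk_mixing (R : realFieldType) K m q (f g : seq bool -> R) :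
  (1 - (192 * 1000)^-1 : R) ^+ K <= 1 / 4 ->
  (forall s, size s = m -> `|f s| <= 1) ->
  (forall s, size s = m -> `|g s| <= 1) ->
  `|mean m (fun x => f x * walk_avg (K * q) g x) - mean m f * mean m g|
    <= (2 ^ q)%:R^-1.
Proof.
move=> hK f1 g1.
pose g0 s := g s - mean m g.
have g00 : mean m g0 = 0 by rewrite meanB mean_const subrr.
have wg x : walk_avg (K * q) g x = walk_avg (K * q) g0 x + mean m g.
  by rewrite /walk_avg meanB mean_const subrK.
have -> : mean m (fun x => f x * walk_avg (K * q) g x) - mean m f * mean m g =
    mean m (fun x => f x * walk_avg (K * q) g0 x).
  rewrite (mulrC (mean m f)) -meanZ -meanB; apply: eq_mean => s _.
  by rewrite wg; ring.
set l : R := (2 ^ q)%:R^-1.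
have l0 : 0 < l by rewrite invr_gt0 ltr0n expn_gt0.
have e0 : energy m g0 <= 1.
  have -> : energy m g0 = energy m g - mean m g ^+ 2.
    have -> : mean m g ^+ 2 = 2 * mean m g * mean m g - mean m (fun=> mean m g ^+ 2).
      by rewrite mean_const; ring.
    rewrite /energy -meanZ -!meanB; apply: eq_mean => s _; rewrite /g0; ring.
  have : energy m g <= 1.
    rewrite -(mean_const m (1 : R)); apply: le_mean => s /g1.
    by rewrite -real_normK ?num_real // => h; rewrite exprn_ile1.
  have := sqr_ge0 (mean m g); lra.
have e1 : energy m (walk_avg (K * q) g0) <= l ^+ 2.
  apply: le_trans (energy_walk_avg (K * q) g00) _; rewrite exprM.
  have -> : l ^+ 2 = (1 / 4) ^+ q * 1.
    by rewrite mulr1 /l natrX -exprVn exprAC; congr (_ ^+ q); field.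
  have r0 : 0 <= 1 - (192 * 1000)^-1 :> R.
    lra.
  rewrite ler_pM ?energy_ge0 ?exprn_ge0 //.
  by rewrite lerXn2r ?nnegrE ?exprn_ge0 // divr_ge0.
(* AM-GM with weight [l], in place of Cauchy-Schwarz. *)
have bound x : size x = m -> `|f x * walk_avg (K * q) g0 x| <=
    2^-1 * (l + l^-1 * walk_avg (K * q) g0 x ^+ 2).
  move=> /f1; rewrite normrM; set w := walk_avg _ _ _.
  rewrite -(real_normK (num_real w)); move: `|w| (normr_ge0 w) => v v0 fx1.
  have -> : 2^-1 * (l + l^-1 * v ^+ 2) = v + l^-1 * (l - v) ^+ 2 / 2.
    by field; rewrite gt_eqF.
  have : 0 <= l^-1 * (l - v) ^+ 2 / 2.
    by rewrite divr_ge0 // mulr_ge0 ?sqr_ge0 // invr_ge0 ltW.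
  have : `|f x| * v <= v by rewrite ler_piMl.
  lra.
have abs_mean (F : seq bool -> R) : `|mean m F| <= mean m (fun s => `|F s|).
  rewrite ler_norml -meanN; apply/andP; split; apply: le_mean => s _.
    by rewrite lerNl -normrN ler_norm.
  exact: ler_norm.
apply: le_trans (abs_mean _) _; apply: le_trans (le_mean bound) _.
rewrite meanZ meanD mean_const meanZ -/(energy _ _).
have : l^-1 * energy m (walk_avg (K * q) g0) <= l.
  by rewrite mulrC ler_pdivrMr // -expr2.
lra.
Qed.

(** * The generator *)

Fixpoint gen (rs : seq nat) (w : seq bool) : seq (seq bool) :=
  if rs is r :: rs' then
    gen rs' (drop (5 * r) w) ++ gen rs' (walk r (take (5 * r) w) (drop (5 * r) w))
  else [:: w].

(** As [K] steps halve the error, a level reaches 2^-(2^h' L + c), which is still 2^-c after summing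
    over the at most 2^(2^h' L) label sequences of the first half. *)
Fixpoint schedule (K L c h : nat) : seq nat :=
  if h is h'.+1 then (K * (2 ^ h' * L + c))%N :: schedule K L c h' else [::].

Definition seed_length (n : nat) (rs : seq nat) : nat := (5 * sumn rs + n)%N.

(** A tree becomes a strategy [st]: the next label as a function of the path so far and the block.
    With the whole path kept, the test on the second half is the same strategy started from a longer
    path. *)
Definition extend (Sigma : Type) (st : seq Sigma -> seq bool -> Sigma)
    (p : seq Sigma) (w : seq bool) : seq Sigma := rcons p (st p w).

Fixpoint ideal (R : realFieldType) (n : nat) (Sigma : Type)
    (st : seq Sigma -> seq bool -> Sigma) (N : nat) (phi : seq Sigma -> R)
    (p : seq Sigma) : R :=
  if N is N'.+1 then mean n (fun w => ideal n st N' phi (extend st p w)) else phi p.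

Lemma size_schedule K L c h : size (schedule K L c h) = h.
Proof. by elim: h => //= h ->. Qed.

Lemma size_act gs y x : (forall i s, size (nth id gs i s) = size s) ->
  size (act gs y x) = size x.
Proof.
elim: gs y x => [|g gs IH] [|[] y] x gS //; rewrite [act _ _ _]/(act gs y _).
  by rewrite IH ?(gS 0%N) // => i; apply: (gS i.+1).
by rewrite IH // => i; apply: (gS i.+1).
Qed.

Lemma size_generators i s : size (nth id generators i s) = size s.
Proof.
case: i => [|[|[|[|[|i]]]]] /=; rewrite ?size_xor_next ?size_xor_prev ?size_flip_head //.
by rewrite nth_nil.
Qed.

Lemma size_walk r y x : size (walk r y x) = size x.
Proof.
by elim: r y x => //= r IH y x; rewrite IH size_act //; apply: size_generators.
Qed.

Lemma size_gen rs w : size (gen rs w) = (2 ^ size rs)%N.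
Proof. by elim: rs w => //= r rs IH w; rewrite size_cat !IH expnS mul2n addnn. Qed.

Lemma all_size_gen n rs w : size w = seed_length n rs ->
  all (fun s => size s == n) (gen rs w).
Proof.
rewrite /seed_length; elim: rs w => /= [|r rs IH] w sw; first by rewrite sw eqxx.
by rewrite all_cat !IH // ?size_walk size_drop sw mulnDr -addnA addKn.
Qed.

Lemma foldl_extend Sigma (st : seq Sigma -> seq bool -> Sigma) p ws :
  exists2 t, foldl (extend st) p ws = p ++ t & size t = size ws.
Proof.
elim: ws p => [|w ws IH] p /=; first by exists [::]; rewrite ?cats0.
have [t -> st'] := IH (extend st p w); exists (st p w :: t); last by rewrite /= st'.
by rewrite /extend cat_rcons.
Qed.

Lemma ideal_addn (R : realFieldType) n Sigma (st : seq Sigma -> seq bool -> Sigma) a b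
    (phi : seq Sigma -> R) p :
  ideal n st (a + b) phi p = ideal n st a (ideal n st b phi) p.
Proof. by elim: a p => //= a IH p; apply: eq_mean => w _. Qed.

Lemma eq_ideal (R : realFieldType) n Sigma (st : seq Sigma -> seq bool -> Sigma) N
    (phi psi : seq Sigma -> R) p :
  (forall t, size t = N -> phi (p ++ t) = psi (p ++ t)) ->
  ideal n st N phi p = ideal n st N psi p.
Proof.
elim: N p => [|N IH] p e /=; first by rewrite -(cats0 p) e.
apply: eq_mean => w _; apply: IH => t tN.
by rewrite /extend cat_rcons e //= tN.
Qed.

Lemma ideal_norm_le1 (R : realFieldType) n Sigma (st : seq Sigma -> seq bool -> Sigma) N
    (phi : seq Sigma -> R) p :
  (forall q, `|phi q| <= 1) -> `|ideal n st N phi p| <= 1.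
Proof.
by move=> h; elim: N p => //= N IH p; apply: ler_norm_mean => w _; apply: IH.
Qed.

Lemma sum_indicator (R : realFieldType) (Sigma : finType) N p (F : seq Sigma -> R) q :
  (exists2 t, q = p ++ t & size t = N) ->
  \sum_(t : N.-tuple Sigma) (q == p ++ t)%:R * F (p ++ t) = F q.
Proof.
case=> t -> tN; have tN' : size t == N by rewrite tN.
rewrite (bigD1 (Tuple tN')) //= eqxx mul1r big1 ?addr0 // => t' neq.
rewrite eqseq_cat // eqxx /= eq_sym (_ : (tval t' == t) = false) ?mul0r //.
by apply: contraNF neq => /eqP e; apply/eqP/val_inj.
Qed.

(* The first half of the output determines the vertex [A x] reached half-way, one
   of [|Sigma| ^ 2 ^ h] possibilities; for each of them the mixing property makes
   the seed of the second half independent of the event that it is reached. *)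
Lemma gen_fools (R : realFieldType) (K L c n : nat) (Sigma : finType)
    (st : seq Sigma -> seq bool -> Sigma) h (phi : seq Sigma -> R) p :
  (1 - (192 * 1000)^-1 : R) ^+ K <= 1 / 4 ->
  (#|Sigma| <= 2 ^ L)%N -> (forall q, `|phi q| <= 1) ->
  `|mean (seed_length n (schedule K L c h))
      (fun w => phi (foldl (extend st) p (gen (schedule K L c h) w)))
    - ideal n st (2 ^ h) phi p| <= ((2 ^ h)%:R - 1) / (2 ^ c)%:R.
Proof.
move=> hK hL; elim: h phi p => [|h IH] phi p phi1.
  rewrite subrr normr0 (_ : (2 ^ 0)%:R - 1 = 0) ?mul0r //; exact: subrr.
set e := _ / _ in IH; rewrite /= /seed_length /= mulnDr -addnA.
set q := (2 ^ h * L + c)%N; set rs := schedule K L c h in IH *.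
set r := (K * q)%N; rewrite -/(seed_length n rs); set m := seed_length n rs in IH *.
pose A x := foldl (extend st) p (gen rs x).
pose g p' z := phi (foldl (extend st) p' (gen rs z)).
have Aex x : exists2 t, A x = p ++ t & size t = (2 ^ h)%N.
  have [t At tN] := foldl_extend st p (gen rs x); exists t => //.
  by rewrite tN size_gen size_schedule.
have -> : mean (5 * r + m) (fun w => phi (foldl (extend st) p
    (gen rs (drop (5 * r) w) ++ gen rs (walk r (take (5 * r) w) (drop (5 * r) w))))) =
  mean m (fun x => walk_avg r (g (A x)) x).
  rewrite mean_addn mean_exchange; apply: eq_mean => x _; apply: eq_mean => y ym.
  by rewrite drop_size_cat // take_size_cat // foldl_cat.
have -> : mean m (fun x => walk_avg r (g (A x)) x) =
    \sum_(t : (2 ^ h).-tuple Sigma)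
      mean m (fun x => (A x == p ++ t)%:R * walk_avg r (g (p ++ t)) x).
  rewrite -mean_sum; apply: eq_mean => x _.
  by rewrite (sum_indicator (fun p' => walk_avg r (g p') x)).
set S1 := \sum_t _; pose S2 := \sum_(t : (2 ^ h).-tuple Sigma)
  mean m (fun x => (A x == p ++ t)%:R) * mean m (g (p ++ t)).
(* Mixing costs 2^-q for each half-way vertex, and there are at most 2^(2^h L) of them. *)
have e12 : `|S1 - S2| <= ((2 ^ c)%:R)^-1.
  rewrite /S1 /S2 -sumrB; apply: le_trans (ler_norm_sum _ _ _) _.
  apply: le_trans (ler_sum (G := fun=> (2 ^ q)%:R^-1) _ _) _ => [t _|].
    apply: walk_mixing => // s _; last exact: phi1.
    by case: (_ == _); rewrite ?normr1 ?normr0.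
  rewrite sumr_const card_tuple -[X in X <= _]mulr_natl /q expnD natrM invfM mulrA.
  rewrite ler_piMl ?invr_ge0 // ler_pdivrMr ?ltr0n ?expn_gt0 // mul1r ler_nat.
  by rewrite mulnC expnM leq_exp2r ?expn_gt0.
(* Hybrids: the walk is replaced by an independent seed, then the second half by ideal blocks, then
   the first, where the test is itself an [ideal] value. So e_(h+1) = 2^-c + 2 e_h, which solves to
   the stated bound. *)
have -> : S1 - ideal n st (2 ^ h.+1) phi p = (S1 - S2) +
  (mean m (fun x => mean m (g (A x)) - ideal n st (2 ^ h) phi (A x)) +
  (mean m (fun x => ideal n st (2 ^ h) phi (A x)) - ideal n st (2 ^ h.+1) phi p)).
  rewrite meanB; suff -> : S2 = mean m (fun x => mean m (g (A x))) by ring.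
  rewrite /S2 (eq_mean (g := fun x => \sum_(t : (2 ^ h).-tuple Sigma)
     mean m (g (p ++ t)) * (A x == p ++ t)%:R)).
    by rewrite mean_sum; apply: eq_bigr => t _; rewrite meanZ mulrC.
  move=> x _; rewrite -(sum_indicator (fun p' => mean m (g p')) (Aex x)).
  by apply: eq_bigr => t _; rewrite mulrC.
have e3 : `|mean m (fun x => mean m (g (A x)) - ideal n st (2 ^ h) phi (A x))| <= e.
  by apply: ler_norm_mean => x _; apply: IH.
have e4 : `|mean m (fun x => ideal n st (2 ^ h) phi (A x)) -
    ideal n st (2 ^ h.+1) phi p| <= e.
  rewrite expnS mul2n -addnn ideal_addn; apply: IH => p'.
  exact: ideal_norm_le1.
apply: le_trans (ler_normD _ _) _; apply: le_trans (lerD e12 (ler_normD _ _)) _.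
apply: le_trans (lerD (lexx _) (lerD e3 e4)) _.
by rewrite /e expnS natrM; lra.
Qed.

(** * Block decision trees as strategies *)

Definition to_bits n (w : seq bool) : bits n := [tuple nth false w j | j < n].

Lemma to_bitsK n (X : bits n) : to_bits n X = X.
Proof. by apply: eq_from_tnth => j; rewrite tnth_mktuple (tnth_nth false). Qed.

(** [d] answers past the leaves: the recursion produces 2^h >= k blocks, and the surplus labels are
    cut off afterwards. *)
Fixpoint tree_strategy n (Sigma : Type) (d : Sigma) h (T : block_tree n Sigma h)
    (p : seq Sigma) (w : seq bool) : Sigma :=
  match T with
  | Node _ v child =>
      if p is a :: p' then tree_strategy d (child a) p' w else v (to_bits n w)
  | _ => d
  end.

Lemma tree_walk_strategy n (Sigma : Type) (d : Sigma) h (T : block_tree n Sigma h) Xs :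
  size Xs = h ->
  tree_walk T Xs = foldl (extend (tree_strategy d T)) [::] (map val Xs).
Proof.
elim: T Xs => [|h' v child IH] [|X Xs] //= [sX].
rewrite /extend /= to_bitsK IH //; move: (v X) => a.
have cons_foldl p ws : foldl (extend (tree_strategy d (Node v child))) (a :: p) ws =
    a :: foldl (extend (tree_strategy d (child a))) p ws.
  by elim: ws p => //= w ws IHw p; rewrite -IHw.
exact/esym/cons_foldl.
Qed.

Lemma mean_reshape (R : realFieldType) n k Sigma (st : seq Sigma -> seq bool -> Sigma)
    (phi : seq Sigma -> R) p :
  mean (n * k) (fun x => phi (foldl (extend st) p (reshape (nseq k n) x))) =
  ideal n st k phi p.
Proof.
elim: k p => [|k IH] p; first by rewrite muln0.
rewrite mulnS mean_addn /=; apply: eq_mean => w wn; rewrite -IH.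
by apply: eq_mean => x _; rewrite take_size_cat // drop_size_cat.
Qed.

Lemma blocks_reshape n k (x : bits (n * k)) :
  map val (blocks x) = reshape (nseq k n) x.
Proof.
have sx := size_tuple x.
apply: (@eq_from_nth _ [::]); first by rewrite size_map size_tuple size_reshape size_nseq.
move=> i; rewrite size_map size_tuple => ik.
rewrite (nth_map (nseq_tuple n false)) ?size_tuple //.
rewrite (_ : nth _ _ i = block x i); last first.
  by rewrite -(tnth_nth _ _ (Ordinal ik)) tnth_mktuple.
rewrite nth_reshape ?size_nseq // nth_nseq ik take_nseq ?(ltnW ik) // sumn_nseq.
apply: (@eq_from_nth _ false).
  rewrite size_tuple size_takel // size_drop sx.
  by move: ik; nia.
move=> j; rewrite size_tuple => jn.
rewrite nth_take // nth_drop -[LHS](tnth_nth _ _ (Ordinal jn)) tnth_mktuple /=.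
by rewrite (mulnC n i).
Qed.

Lemma reshape_flatten (T : Type) n k (ss : seq (seq T)) :
  (k <= size ss)%N -> all (fun s => size s == n) ss ->
  reshape (nseq k n) (take (n * k) (flatten ss)) = take k ss.
Proof.
elim: k ss => [|k IH] [|s ss] //= kss /andP[/eqP sn ssn].
rewrite mulnS take_cat sn ltnNge leq_addr /= addKn.
by rewrite take_size_cat // drop_size_cat // IH.
Qed.

Lemma size_flatten_gen n rs w : size w = seed_length n rs ->
  size (flatten (gen rs w)) = (n * 2 ^ size rs)%N.
Proof.
move=> /all_size_gen; rewrite -(size_gen rs w).
elim: (gen rs w) => [|s ss IH] /=; first by rewrite muln0.
by case/andP=> /eqP sn /IH e; rewrite size_cat sn e mulnS.
Qed.

(** * Total variation *)

Lemma sum_law (R : realType) (A B : finType) (f : A -> B) (phi : B -> R) :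
  \sum_b phi b * law R f b = (\sum_a phi (f a)) / #|A|%:R.
Proof.
rewrite (partition_big f xpredT) //= mulr_suml; apply: eq_bigr => b _.
rewrite /law mulrA; congr (_ / _).
rewrite (eq_bigr (fun=> phi b)) => [|a /eqP-> //].
rewrite sumr_const -[RHS]mulr_natr; congr (_ * _%:R).
by apply: eq_card => a; rewrite !inE.
Qed.

(** Duality: the l1 distance is attained by the sign of the difference of the laws as test
    function. *)
Lemma tv_dist_le (R : realType) (A A' B : finType) (f : A -> B) (g : A' -> B) (e : R) :
  (forall phi : B -> R, (forall b, `|phi b| <= 1) ->
    `|(\sum_a phi (f a)) / #|A|%:R - (\sum_a phi (g a)) / #|A'|%:R| <= 2 * e) ->
  tv_dist (law R f) (law R g) <= e.
Proof.
move=> h; rewrite /tv_dist ler_pdivrMr // mulrC.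
pose phi b := Num.sg (law R f b - law R g b).
have {h} := h phi; rewrite -!sum_law -sumrB => h.
have -> : \sum_b `|law R f b - law R g b| =
    \sum_b (phi b * law R f b - phi b * law R g b).
  by apply: eq_bigr => b _; rewrite -mulrBr normrEsg.
apply: le_trans (ler_norm _) (h _) => b.
by rewrite normr_sg; case: eqP.
Qed.

(** For the degenerate cases, where both laws are the same point mass although the sample spaces
    differ. *)
Lemma tv_dist_refl (R : realType) (A A' B : finType) (f : A -> B) (g : A' -> B) :
  (0 < #|A|)%N -> (0 < #|A'|)%N -> (forall a a', f a = g a') ->
  tv_dist (law R f) (law R g) = 0.
Proof.
move=> /card_gt0P[a0 _] /card_gt0P[a1 _] fg; apply/eqP; rewrite -[_ == _]negbK.
have lawE (C : finType) (k : C -> B) (c0 : C) b : (forall c, k c = k c0) ->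
    law R k b = (k c0 == b)%:R.
  move=> kc; rewrite /law (_ : [set a | k a == b] = if k c0 == b then setT else set0).
    case: ifP => _; rewrite ?cardsT ?cards0 ?mul0r // divff // pnatr_eq0 -lt0n.
    by apply/card_gt0P; exists c0.
  by apply/setP => c; rewrite inE kc; case: ifP; rewrite inE.
rewrite negbK /tv_dist big1 ?mul0r // => b _.
rewrite (lawE _ f a0) ?(lawE _ g a1) => [|c|c].
- by rewrite (fg a0 a1) subrr normr0.
- by rewrite -(fg a0) (fg a0 a1).
- by rewrite (fg c a1) (fg a0 a1).
Qed.

Lemma gen_block_prg (R : realType) (gamma : R) (K L c n k h : nat) (Sigma : finType)
    (Gen : bits (seed_length n (schedule K L c h)) -> bits (n * k)) :
  (1 - (192 * 1000)^-1 : R) ^+ K <= 1 / 4 ->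
  (#|Sigma| <= 2 ^ L)%N -> (0 < #|Sigma|)%N -> (k <= 2 ^ h)%N ->
  (2 ^ h)%:R / (2 ^ c)%:R <= gamma ->
  (forall u, tval (Gen u) = take (n * k) (flatten (gen (schedule K L c h) u))) ->
  block_prg gamma Sigma Gen.
Proof.
move=> hK hL /card_gt0P[d _] kh hg GenE T; apply: tv_dist_le => phi phi1.
set st := tree_strategy d T.
pose psi p := phi (insub_bseq k p).
have evalE (x : bits (n * k)) : phi (tree_eval T (blocks x)) =
    psi (foldl (extend st) [::] (reshape (nseq k n) x)).
  rewrite -blocks_reshape -(tree_walk_strategy d T (Xs := blocks x)) ?size_tuple //.
  congr phi; apply: val_inj => /=; rewrite insubdK //.
  exact: size_tree_walk.
have bits_card m : #|{: bits m}|%:R = (2 ^ m)%:R :> R by rewrite card_tuple card_bool.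
have -> : (\sum_a phi (tree_eval T (blocks a))) / #|{: bits (n * k)}|%:R =
    ideal n st k psi [::].
  rewrite -mean_reshape mean_tuple bits_card; congr (_ / _).
  by apply: eq_bigr => x _; apply: evalE.
have -> : (\sum_a phi (tree_eval T (blocks (Gen a)))) /
   #|{: bits (seed_length n (schedule K L c h))}|%:R =
   mean (seed_length n (schedule K L c h)) (fun w =>
     psi (take k (foldl (extend st) [::] (gen (schedule K L c h) w)))).
  rewrite mean_tuple bits_card; congr (_ / _); apply: eq_bigr => u _.
  have sg : size (gen (schedule K L c h) u) = (2 ^ h)%N.
    by rewrite size_gen size_schedule.
  rewrite evalE GenE reshape_flatten ?sg //; last by apply: all_size_gen; rewrite size_tuple.
  rewrite -{2}(cat_take_drop k (gen _ u)) foldl_cat.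
  set p := foldl _ _ (take k _).
  have [t ->  _] := foldl_extend st p (drop k (gen (schedule K L c h) u)).
  rewrite take_size_cat // /p.
  have [t' -> ->] := foldl_extend st [::] (take k (gen (schedule K L c h) u)).
  by rewrite size_takel // sg.
(* The test ignores labels after the [k]-th, so the surplus ideal blocks integrate out. *)
have -> : ideal n st k psi [::] = ideal n st (2 ^ h) (fun p => psi (take k p)) [::].
  rewrite -(subnKC kh) ideal_addn; apply: eq_ideal => p /= pk.
  have -> : psi p = psi (take k p) by rewrite -pk take_size.
  have {pk} : (k <= size p)%N by rewrite pk.
  elim: (_ - _)%N p => //= j IH p kp.
  rewrite (eq_mean (g := fun=> psi (take k p))) ?mean_const // => w _.
  rewrite -IH ?size_rcons ?(leqW kp) //.
  by rewrite /extend -cats1 takel_cat.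
have := gen_fools (phi := fun p => psi (take k p)) c n st h [::] hK hL.
move=> /(_ (fun q => phi1 _)) /le_trans; apply.
have p0 : 0 <= (2 ^ c)%:R^-1 :> R by rewrite invr_ge0.
have h0 : 0 <= (2 ^ h)%:R / (2 ^ c)%:R :> R by rewrite divr_ge0.
by rewrite mulrBl; lra.
Qed.

Local Open Scope nat_scope.

(** * Stack programs *)

Notation store := (nat -> seq bool).

Definition upd (s : store) (i : nat) (v : seq bool) : store :=
  fun j => if j == i then v else s j.

Inductive cmd :=
| Skip
| Push of nat & bool
| Pop of nat
| Seq of cmd & cmd
| Case of nat & cmd & cmd & cmd
| While of pred (option bool) & nat & cmd.

(** The costs are the exact step counts of the compiled code: two machine steps for a push, a branch
    and the jump out for [Case], a branch and the jump back for each iteration. *)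
Inductive exec : cmd -> store -> nat -> store -> Prop :=
| ExSkip s : exec Skip s 0 s
| ExPush i b s : exec (Push i b) s 2 (upd s i (b :: s i))
| ExPop i s : exec (Pop i) s 1 (upd s i (behead (s i)))
| ExSeq c d s t s1 t' s2 :
    exec c s t s1 -> exec d s1 t' s2 -> exec (Seq c d) s (t + t') s2
| ExCase i ct cf ce s t s' :
    exec (if ohead (s i) is Some b then if b then ct else cf else ce) s t s' ->
    exec (Case i ct cf ce) s (t + 2) s'
| ExStop (p : pred (option bool)) i c s :
    ~~ p (ohead (s i)) -> exec (While p i c) s 1 s
| ExLoop (p : pred (option bool)) i c s t s1 t' s2 :
    p (ohead (s i)) -> exec c s t s1 -> exec (While p i c) s1 t' s2 ->
    exec (While p i c) s (t + t' + 2) s2.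

Fixpoint regs_below (n : nat) (c : cmd) : bool :=
  match c with
  | Skip => true
  | Push i _ => i < n
  | Pop i => i < n
  | Seq c d => regs_below n c && regs_below n d
  | Case i ct cf ce =>
      [&& i < n, regs_below n ct, regs_below n cf & regs_below n ce]
  | While _ i c => (i < n) && regs_below n c
  end.

(** * Compilation to Turing machines *)

Inductive instr :=
| IPush of nat & bool
| IPop of nat
| IBranch of nat & (option bool -> nat).

Fixpoint code_size (c : cmd) : nat :=
  match c with
  | Skip => 0
  | Push _ _ => 1
  | Pop _ => 1
  | Seq c d => code_size c + code_size d
  | Case _ ct cf ce => 4 + (code_size ct + (code_size cf + code_size ce))
  | While _ _ c => (code_size c).+2
  end.

Definition goto (l : nat) : instr := IBranch 0 (fun=> l).

(* [l] is the address at which the code is placed. *)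
Fixpoint code (c : cmd) (l : nat) : seq instr :=
  match c with
  | Skip => [::]
  | Push i b => [:: IPush i b]
  | Pop i => [:: IPop i]
  | Seq c d => code c l ++ code d (l + code_size c)
  | Case i ct cf ce =>
      let lf := (l.+1 + code_size ct).+1 in
      let le := (lf + code_size cf).+1 in
      let exit := (le + code_size ce).+1 in
      IBranch i (fun o => if o is Some b then if b then l.+1 else lf else le)
      :: (code ct l.+1 ++ goto exit :: (code cf lf ++ goto exit ::
         (code ce le ++ [:: goto exit])))
  | While p i c =>
      IBranch i (fun o => if p o then l.+1 else (l.+1 + code_size c).+1)
      :: (code c l.+1 ++ [:: goto l])
  end.

Lemma size_code c l : size (code c l) = code_size c.
Proof.
elim: c l => //= [c IHc d IHd|i ct IHt cf IHf ce IHe|p i c IHc] l.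
- by rewrite size_cat IHc IHd.
- rewrite size_cat IHt /= size_cat IHf /= size_cat IHe /=; lia.
- by rewrite size_cat IHc /= addn1.
Qed.

Definition segment (cs : seq instr) (l : nat) (s : seq instr) : Prop :=
  exists pre post, cs = pre ++ s ++ post /\ size pre = l.

Lemma segment_cat cs l s1 s2 : segment cs l (s1 ++ s2) ->
  segment cs l s1 /\ segment cs (l + size s1) s2.
Proof.
case=> pre [post [-> <-]]; split; first by exists pre, (s2 ++ post); rewrite -catA.
by exists (pre ++ s1), post; rewrite size_cat -!catA.
Qed.

Lemma segment_cons cs l x s : segment cs l (x :: s) ->
  onth cs l = Some x /\ segment cs l.+1 s.
Proof.
case=> pre [post [-> <-]]; split.
  by rewrite onth_cat ltnn subnn.
by exists (rcons pre x), post; rewrite size_rcons cat_rcons.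
Qed.

Lemma segment_size cs l s : segment cs l s -> l + size s <= size cs.
Proof. by case=> pre [post [-> <-]]; rewrite !size_cat; lia. Qed.

(* A push takes two steps, the Boolean in the state telling them apart: the head
   first moves left and then writes. *)
Definition machine_delta (n : nat) (cs : seq instr)
    (q : 'I_(size cs).+1 * bool) (r : {ffun 'I_n.+1 -> cell}) :
    option (('I_(size cs).+1 * bool) * ('I_n.+1 -> cell * direction)) :=
  let next l := (inord l : 'I_(size cs).+1, false) in
  match onth cs q.1 with
  | None => None
  | Some (IPush i b) =>
      if q.2 then
        Some (next q.1.+1,
              fun j => if j == inord i then (Some b, Stay) else (r j, Stay))
      else
        Some ((q.1, true),
              fun j => if j == inord i then (r j, GoLeft) else (r j, Stay))
  | Some (IPop i) =>
      Some (next q.1.+1,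
            fun j => if j == inord i then (None, GoRight) else (r j, Stay))
  | Some (IBranch i f) => Some (next (f (r (inord i))), fun j => (r j, Stay))
  end.

(** The additional address [size cs] is where control falls off the code; [onth] is [None] there and
    the machine halts. *)
Definition machine (n : nat) (out : 'I_n.+1) (cs : seq instr) : turing_machine :=
  @TuringMachine n.+1 out ('I_(size cs).+1 * bool)%type (ord0, false)
    (@machine_delta n cs).

(** The top of the stack is under the head. Visited blank cells remain explicit in the lists, so a
    stack determines its tape only up to blanks. *)
Definition stack_tape (t : tape) (s : seq bool) : Prop :=
  (exists a, tleft t = nseq a None) /\
  exists b, tright t = map some s ++ nseq b None.

Definition at_address n out cs (c : tm_config (@machine n out cs)) (l : nat)
    (s : store) : Prop :=
  [/\ nat_of_ord c.1.1 = l, c.1.2 = false & forall i : 'I_n.+1, stack_tape (c.2 i) (s i)].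

Lemma stack_tape_read t s : stack_tape t s -> tape_read t = ohead s.
Proof. by rewrite /tape_read => -[_ [b ->]]; case: s => //=; case: b. Qed.

Lemma stack_tape_stay t s : stack_tape t s ->
  stack_tape (tape_act t (tape_read t, Stay)) s.
Proof.
move=> ts; rewrite (stack_tape_read ts); case: ts => lt [b rt]; split=> //=.
rewrite rt; case: s {rt} => [|x s]; last by exists b.
by case: b => [|b]; [exists 1 | exists b.+1].
Qed.

Lemma stack_tape_pop t s : stack_tape t s ->
  stack_tape (tape_act t (None, GoRight)) (behead s).
Proof.
case=> [[a lt] [b rt]]; split => /=; first by exists a.+1; rewrite lt.
by rewrite rt; case: s {rt} => [|x s]; [case: b => [|b]; [exists 0 | exists b] | exists b].
Qed.

Lemma stack_tape_push t s b : stack_tape t s ->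
  stack_tape (tape_act (tape_act t (tape_read t, GoLeft)) (Some b, Stay)) (b :: s).
Proof.
move=> ts; have [_ [c' rt']] := stack_tape_stay ts.
case: ts => [[a lt] _]; split => /=.
  by exists a.-1; rewrite lt; case: (a).
by exists c'; move: rt' => /= ->.
Qed.

Lemma tm_run_step M t (c c' : tm_config M) :
  tm_step c = Some c' -> tm_run t.+1 c = tm_run t c'.
Proof. by move=> /= ->. Qed.

(** Quantifying over the remaining fuel [r] lets runs be composed without reference to halting. *)
Definition reaches n out cs (c : tm_config (@machine n out cs)) (t l : nat)
    (s : store) : Prop :=
  exists2 c', at_address c' l s & forall r, tm_run (t + r) c = tm_run r c'.

Lemma reaches_trans n out cs (c : tm_config (@machine n out cs)) t l s t' l' s' :
  reaches c t l s ->
  (forall c', at_address c' l s -> @reaches n out cs c' t' l' s') ->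
  reaches c (t + t') l' s'.
Proof.
case=> c' at' run' /(_ c' at') [c'' at'' run'']; exists c'' => // r.
by rewrite -addnA run' run''.
Qed.

Lemma reaches_branch n out cs (c : tm_config (@machine n out cs)) l s i f :
  onth cs l = Some (IBranch i f) -> i <= n -> f (ohead (s i)) <= size cs ->
  at_address c l s -> reaches c 1 (f (ohead (s i))) s.
Proof.
case: c => [[q ph] ts] csl ni fs [/= ql phF tss]; subst l ph.
have rd : tape_read (ts (inord i)) = ohead (s i).
  by have := stack_tape_read (tss (inord i)); rewrite inordK.
eexists; last first.
  by move=> r; apply: tm_run_step; rewrite /tm_step /= /machine_delta csl ffunE rd.
split=> [||j] //=; first by rewrite inordK.
by rewrite ffunE; apply: stack_tape_stay.
Qed.

Lemma reaches_goto n out cs (c : tm_config (@machine n out cs)) l l' s :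
  onth cs l = Some (goto l') -> l' <= size cs ->
  at_address c l s -> reaches c 1 l' s.
Proof. by move=> csl l's; apply: (reaches_branch csl). Qed.

Lemma reaches_pop n out cs (c : tm_config (@machine n out cs)) l s i :
  onth cs l = Some (IPop i) -> i <= n -> l < size cs ->
  at_address c l s -> reaches c 1 l.+1 (upd s i (behead (s i))).
Proof.
case: c => [[q ph] ts] csl ni ls [/= ql phF tss]; subst l ph.
eexists; last first.
  by move=> r; apply: tm_run_step; rewrite /tm_step /= /machine_delta csl.
split=> [||j] //=; first by rewrite inordK.
rewrite /upd -(inj_eq val_inj) /= inordK //; case: eqP => [<-|_].
  exact: stack_tape_pop.
by rewrite ffunE; apply: stack_tape_stay.
Qed.

Lemma reaches_push n out cs (c : tm_config (@machine n out cs)) l s i b :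
  onth cs l = Some (IPush i b) -> i <= n -> l < size cs ->
  at_address c l s -> reaches c 2 l.+1 (upd s i (b :: s i)).
Proof.
case: c => [[q ph] ts] csl ni ls [/= ql phF tss]; subst l ph.
eexists; last first.
  move=> r; apply: etrans.
    by apply: tm_run_step; rewrite /tm_step /= /machine_delta csl.
  by apply: tm_run_step; rewrite /tm_step /= /machine_delta csl.
split=> [||j] //=; first by rewrite inordK.
rewrite /upd -(inj_eq val_inj) /= inordK // !ffunE -(inj_eq val_inj) /= inordK //.
case: eqP => [<-|_]; first exact: stack_tape_push.
exact/stack_tape_stay/stack_tape_stay.
Qed.

Lemma exec_reaches n out cs c s t s' : exec c s t s' -> regs_below n.+1 c ->
  forall l, segment cs l (code c l) ->
  forall cfg : tm_config (@machine n out cs), at_address cfg l s ->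
  reaches cfg t (l + code_size c) s'.
Proof.
elim=> {c s t s'} [s|i b s|i s|c d s t s1 t' s2 _ IHc _ IHd|i ct cf ce s t s' _ IH
  |p i c s np|p i c s t s1 t' s2 ps _ IHc _ IHw] /=.
- by move=> _ l _ cfg at_l; rewrite addn0; exists cfg.
- move=> ni l seg cfg; rewrite addn1; have [? _] := segment_cons seg.
  by apply: reaches_push => //; have := segment_size seg; rewrite addn1.
- move=> ni l seg cfg; rewrite addn1; have [? _] := segment_cons seg.
  by apply: reaches_pop => //; have := segment_size seg; rewrite addn1.
- case/andP=> wc wd l /segment_cat[sc sd] cfg at_l; rewrite size_code in sd.
  apply: reaches_trans (IHc wc _ sc _ at_l) _ => c' at'.
  by rewrite addnA; apply: IHd.
- case/and4P=> ni wt wf we l seg cfg at_l.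
  have := segment_size seg; rewrite /= !(size_cat, size_code) /=.
  rewrite !(size_cat, size_code) /= !(size_cat, size_code) /= => le_cs.
  have [csl /segment_cat[st]] := segment_cons seg; rewrite size_code.
  case/segment_cons=> gt /segment_cat[sf]; rewrite size_code.
  case/segment_cons=> gf /segment_cat[se]; rewrite size_code.
  case/segment_cons=> ge _.
  have exitE : l + (4 + (code_size ct + (code_size cf + code_size ce))) =
     ((((l.+1 + code_size ct).+1 + code_size cf).+1) + code_size ce).+1 by lia.
  rewrite exitE (_ : t + 2 = 1 + (t + 1)); last by lia.
  apply: (reaches_trans (reaches_branch csl _ _ at_l)) => //.
    by case: (ohead _) => [[]|]; lia.
  case: (ohead (s i)) IH => [[]|] IH c' at'.
  + apply: (reaches_trans (IH wt _ st _ at')) => c'' at''.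
    by apply: (reaches_goto gt) at''; lia.
  + apply: (reaches_trans (IH wf _ sf _ at')) => c'' at''.
    by apply: (reaches_goto gf) at''; lia.
  + apply: (reaches_trans (IH we _ se _ at')) => c'' at''.
    by apply: (reaches_goto ge) at''; lia.
- case/andP=> ni wc l seg cfg at_l; have [csl _] := segment_cons seg.
  have := segment_size seg; rewrite /= !(size_cat, size_code) /= => le_cs.
  rewrite (_ : l + _ = (l.+1 + code_size c).+1); last by lia.
  have := reaches_branch csl ni _ at_l; rewrite (negbTE np); apply; lia.
- case/andP=> ni wc l seg cfg at_l; have := segment_size seg.
  rewrite /= !(size_cat, size_code) /= => le_cs.
  have [csl /segment_cat[sc]] := segment_cons seg; rewrite size_code.
  case/segment_cons=> gl _.
  rewrite (_ : t + t' + 2 = 1 + (t + (1 + t'))); last by lia.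
  have br := reaches_branch csl ni _ at_l; rewrite ps in br.
  apply: (reaches_trans (br _)) => [|c1 at1]; first by lia.
  apply: (reaches_trans (IHc wc _ sc _ at1)) => c2 at2.
  apply: (reaches_trans (reaches_goto gl _ at2)) => [|c3 at3]; first by lia.
  by apply: IHw => //=; rewrite ni.
Qed.

Lemma exec_computes n (out : 'I_n.+1) c ins t s : regs_below n.+1 c ->
  exec c (nth [::] ins) t s ->
  tm_computes_in (machine out (code c 0)) ins (s out) t.
Proof.
move=> wc ex; have seg : segment (code c 0) 0 (code c 0).
  by exists [::], [::]; rewrite cats0.
have at0 : at_address (tm_init (machine out (code c 0)) ins) 0 (nth [::] ins).
  split=> // i; split; first by exists 0.
  by exists 0; rewrite cats0.
have [c' [c'l _ c's] run] := exec_reaches ex wc seg at0.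
exists c'; last first.
  rewrite /tm_output; have [_ [b ->]] := c's out.
  by elim: (s out) => [|x l /= ->] //; case: b.
rewrite -(addn0 t) run /= /tm_step /= /machine_delta c'l /= add0n onth_default //.
by rewrite size_code.
Qed.

(** * Program logic with time bounds *)

Definition runs (c : cmd) (s : store) (T : nat) (s' : store) : Prop :=
  exists2 t, t <= T & exec c s t s'.

Lemma runs_weaken c s T T' s' : runs c s T s' -> T <= T' -> runs c s T' s'.
Proof. by case=> t tT ex TT'; exists t => //; apply: leq_trans TT'. Qed.

Lemma runs_eq c s T T' s' s'' : runs c s T s' -> s' = s'' -> T <= T' -> runs c s T' s''.
Proof. by move=> ex <-; apply: runs_weaken. Qed.

Lemma runs_skip s : runs Skip s 0 s.
Proof. by exists 0 => //; constructor. Qed.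

Lemma runs_push i b s : runs (Push i b) s 2 (upd s i (b :: s i)).
Proof. by exists 2 => //; constructor. Qed.

Lemma runs_pop i s : runs (Pop i) s 1 (upd s i (behead (s i))).
Proof. by exists 1 => //; constructor. Qed.

Lemma runs_seq c d s T1 s1 T2 s2 :
  runs c s T1 s1 -> runs d s1 T2 s2 -> runs (Seq c d) s (T1 + T2) s2.
Proof.
case=> t1 t1T ex1 [t2 t2T ex2]; exists (t1 + t2); first exact: leq_add.
exact: ExSeq ex1 ex2.
Qed.

Lemma runs_case i ct cf ce s T s' :
  runs (if ohead (s i) is Some b then if b then ct else cf else ce) s T s' ->
  runs (Case i ct cf ce) s (T + 2) s'.
Proof. by case=> t tT ex; exists (t + 2); [rewrite leq_add2r | constructor]. Qed.

Lemma runs_stop (p : pred (option bool)) i c s :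
  ~~ p (ohead (s i)) -> runs (While p i c) s 1 s.
Proof. by exists 1 => //; apply: ExStop. Qed.

Lemma runs_loop (p : pred (option bool)) i c s T s1 T' s2 :
  p (ohead (s i)) -> runs c s T s1 -> runs (While p i c) s1 T' s2 ->
  runs (While p i c) s (T + T' + 2) s2.
Proof.
move=> ps [t tT ex] [t' tT' ex']; exists (t + t' + 2); first by rewrite !leq_add.
exact: ExLoop ex ex'.
Qed.

Definition for_each (i : nat) (body : bool -> cmd) : cmd :=
  While isSome i (Case i (Seq (Pop i) (body true)) (Seq (Pop i) (body false)) Skip).

Lemma runs_for_nil i body s : s i = [::] -> runs (for_each i body) s 1 s.
Proof. by move=> si; apply: runs_stop; rewrite si. Qed.

Lemma runs_for_cons i body s b r T s1 T' s2 :
  s i = b :: r -> runs (body b) (upd s i r) T s1 ->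
  runs (for_each i body) s1 T' s2 -> runs (for_each i body) s (T + T' + 5) s2.
Proof.
move=> si ex ex'; apply: (@runs_weaken _ _ ((1 + T + 2) + T' + 2)); last by lia.
apply: (runs_loop _ _ ex'); first by rewrite si.
apply: runs_case; rewrite si /=.
have := runs_pop i s; rewrite si /= => pop.
by case: b {si} ex => ex; apply: (runs_seq pop).
Qed.

Lemma upd_id s i : upd s i (s i) = s.
Proof. by apply: functional_extensionality => j; rewrite /upd; case: eqP => [->|]. Qed.

Lemma upd_idE s i v : s i = v -> upd s i v = s.
Proof. by move<-; apply: upd_id. Qed.

Lemma upd_upd s i v w : upd (upd s i v) i w = upd s i w.
Proof. by apply: functional_extensionality => j; rewrite /upd; case: eqP. Qed.

Lemma updE s i v : upd s i v i = v.
Proof. by rewrite /upd eqxx. Qed.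

Lemma updE_neq s i j v : j != i -> upd s i v j = s j.
Proof. by rewrite /upd => /negbTE->. Qed.

Definition move (i j : nat) : cmd := for_each i (fun b => Push j b).

Definition move2 (i j l : nat) : cmd :=
  for_each i (fun b => Seq (Push j b) (Push l b)).

Ltac store_eq :=
  apply: functional_extensionality => ?; rewrite /upd;
  repeat match goal with
  | |- context [?a == ?b] =>
      let H := fresh in
      case H : (a == b); rewrite ?eqxx in H *; try (move/eqP in H; subst)
  end; rewrite ?rev_cons ?cat_rcons //; try congruence; try lia.

Lemma runs_move s i j : i != j ->
  runs (move i j) s (7 * size (s i) + 1) (upd (upd s i [::]) j (rev (s i) ++ s j)).
Proof.
move=> ij; move e: (s i) => l.
elim: l s e => [|b l IH] s e.
  by rewrite (upd_idE e) /= upd_id; apply: runs_for_nil.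
have ji : j != i by rewrite eq_sym.
have push := runs_push j b (upd s i l); rewrite updE_neq // in push.
have := IH (upd (upd s i l) j (b :: s j)); rewrite updE_neq // !updE => /(_ erefl) ex.
apply: runs_eq (runs_for_cons e push ex) _ _; first by store_eq.
by rewrite /=; lia.
Qed.

Lemma runs_move2 s i j l : i != j -> i != l -> j != l ->
  runs (move2 i j l) s (9 * size (s i) + 1)
    (upd (upd (upd s i [::]) j (rev (s i) ++ s j)) l (rev (s i) ++ s l)).
Proof.
move=> ij il jl; move e: (s i) => w.
have [ji li lj] : [/\ j != i, l != i & l != j] by split; rewrite eq_sym.
elim: w s e => [|b w IH] s e.
  by rewrite (upd_idE e) /= !upd_id; apply: runs_for_nil.
have push := runs_seq (runs_push j b (upd s i w)) (runs_push l b _).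
rewrite !updE_neq // in push.
pose s1 := upd (upd (upd s i w) j (b :: s j)) l (b :: s l).
have s1i : s1 i = w by rewrite /s1 /upd (negbTE il) (negbTE ij) eqxx.
have s1j : s1 j = b :: s j by rewrite /s1 /upd (negbTE jl) eqxx.
have ex := IH _ s1i; rewrite s1j [s1 l]updE /s1 in ex.
apply: runs_eq (runs_for_cons e push ex) _ _; first by store_eq.
by rewrite /=; lia.
Qed.

(** Moving reverses a stack, so a copy goes through the scratch stack [t]; [copy_rev] emits its copy
    during the first, reversing pass. *)
Definition copy (i t j : nat) : cmd := Seq (move i t) (move2 t i j).
Definition copy_rev (i t j : nat) : cmd := Seq (move2 i t j) (move t i).

Lemma runs_copy s i t j : i != t -> i != j -> t != j -> s t = [::] ->
  runs (copy i t j) s (16 * size (s i) + 2) (upd s j (s i ++ s j)).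
Proof.
move=> it ij tj st; have [ti ji jt] : [/\ t != i, j != i & j != t].
  by rewrite (eq_sym t) !(eq_sym j).
have mv := runs_move s it.
apply: runs_eq (runs_seq mv (runs_move2 _ ti tj ij)) _ _; last first.
  by rewrite updE st cats0 size_rev; lia.
by rewrite st; store_eq; rewrite ?cats0 ?revK.
Qed.

Lemma runs_copy_rev s i t j : i != t -> i != j -> t != j -> s t = [::] ->
  runs (copy_rev i t j) s (16 * size (s i) + 2) (upd s j (rev (s i) ++ s j)).
Proof.
move=> it ij tj st; have [ti ji jt] : [/\ t != i, j != i & j != t].
  by rewrite (eq_sym t) !(eq_sym j).
have mv := runs_move2 s it ij tj.
apply: runs_eq (runs_seq mv (runs_move _ ti)) _ _; last first.
  by rewrite updE_neq // updE st cats0 size_rev; lia.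
by rewrite st; store_eq; rewrite ?cats0 ?revK.
Qed.

(** * Binary increment *)

(* Least significant bit first. *)
Definition incr_bits (l : seq bool) : seq bool :=
  nseq (find negb l) false ++ true :: drop (find negb l).+1 l.

Fixpoint value (l : seq bool) : nat := if l is b :: l' then b + (value l').*2 else 0.

Lemma value_incr l : value (incr_bits l) = (value l).+1.
Proof.
elim: l => //= -[] l IH; rewrite /incr_bits /= ?drop0 //.
by rewrite -/(incr_bits l) IH; lia.
Qed.

Lemma value_lt l : value l < 2 ^ size l.
Proof. by elim: l => //= b l IH; rewrite expnS; case: b; lia. Qed.

Lemma size_incr l : (value l).+1 < 2 ^ size l -> size (incr_bits l) = size l.
Proof.
elim: l => //= -[] l IH; rewrite /incr_bits /= ?drop0 //.
by rewrite expnS -/(incr_bits l) => h; rewrite IH //; lia.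
Qed.

Lemma size_incr_le l : size (incr_bits l) <= (size l).+1.
Proof. by elim: l => //= -[] l IH; rewrite /incr_bits /= ?drop0. Qed.

Definition incr (i t : nat) : cmd :=
  Seq (While (pred1 (Some true)) i (Seq (Pop i) (Push t false)))
      (Seq (Pop i) (Seq (Push i true) (move t i))).

Lemma runs_incr s i t : i != t -> s t = [::] ->
  runs (incr i t) s (12 * size (s i) + 6) (upd s i (incr_bits (s i))).
Proof.
move=> it st; have ti : t != i by rewrite eq_sym.
have loop : runs (While (pred1 (Some true)) i (Seq (Pop i) (Push t false))) s
    (5 * find negb (s i) + 1)
    (upd (upd s i (drop (find negb (s i)) (s i))) t
       (nseq (find negb (s i)) false ++ s t)).
  move e: (s i) => l; elim: l s e {st} => [|b l IH] s e /=.
    by rewrite (upd_idE e) upd_id; apply: runs_stop; rewrite /= e.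
  case: b e => e /=; last first.
    by rewrite (upd_idE e) upd_id; apply: runs_stop; rewrite /= e.
  have body := runs_seq (runs_pop i s) (runs_push t false _).
  rewrite e /= updE_neq // in body.
  have := IH (upd (upd s i l) t (false :: s t)).
  rewrite updE_neq // !updE => /(_ erefl) ex.
  apply: runs_eq (runs_loop _ body ex) _ _; first by rewrite /= e.
    by store_eq; rewrite -[false :: s t]/(nseq 1 false ++ s t) catA -nseqD addn1.
  by lia.
have fs := find_size negb (s i).
apply: runs_eq (runs_seq loop (runs_seq (runs_pop _ _)
   (runs_seq (runs_push _ _ _) (runs_move _ ti)))) _ _; last first.
  by rewrite /upd !eqxx !(negbTE ti) st cats0 size_nseq; lia.
rewrite st; store_eq; rewrite ?cats0 /incr_bits ?rev_nseq.
by rewrite -drop1 drop_drop add1n.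
Qed.

(** * The generator as a stack program *)

(* Registers 0-4 hold the input [n], [k], [|Sigma|], [ceil (1 / gamma)], seed;
   5: index of the current block; 6: scratch; 7: round counts; 8, 9, 10: working
   copies of 7, 5, 4; 11: walk labels; 12: scratch for the walk; 13: reversed
   output; 14: output; 15: remaining blocks; 16: parity of the position. *)

Definition pass_body (look : nat) (b : bool) : cmd :=
  Case 16
    (Seq (Pop 16) (Seq (Push 16 false)
       (Case look (Push 12 (~~ b)) (Push 12 b) (Push 12 b))))
    (Seq (Pop 16) (Seq (Push 16 true) (Push 12 b)))
    Skip.

(** The top of register 10 is the next unread bit, the right neighbour; the top of 12 is the last
    bit written, the left neighbour. The latter has already been processed, but the neighbours of a
    changing position do not change. *)
Definition pass (look : nat) (p : bool) : cmd :=
  Seq (Push 16 p) (Seq (for_each 10 (pass_body look)) (Seq (Pop 16) (move 12 10))).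

Definition flip_cmd : cmd :=
  Case 10 (Seq (Pop 10) (Push 10 false)) (Seq (Pop 10) (Push 10 true)) Skip.

Definition generator_cmds : seq cmd :=
  [:: pass 10 false; pass 10 true; pass 12 false; pass 12 true; flip_cmd].

Lemma runs_case_cons i ct cf ce s b r T s' : s i = b :: r ->
  runs (if b then ct else cf) s T s' -> runs (Case i ct cf ce) s (T + 2) s'.
Proof. by move=> si ex; apply: runs_case; rewrite si. Qed.

Lemma runs_xor_push look b s :
  runs (Case look (Push 12 (~~ b)) (Push 12 b) (Push 12 b)) s 4
    (upd s 12 ((b (+) head false (s look)) :: s 12)).
Proof.
apply: (@runs_case _ _ _ _ _ 2).
by case: (s look) => [|[] r] /=; rewrite ?addbT ?addbF; apply: runs_push.
Qed.

Lemma runs_pass_body look s b p : look != 16 -> s 16 = [:: p] ->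
  runs (pass_body look b) s 9
    (upd (upd s 16 [:: ~~ p]) 12 ((b (+) (p && head false (s look))) :: s 12)).
Proof.
move=> l16 s16; rewrite /pass_body; case: p s16 => s16.
  apply: runs_eq (runs_case_cons Skip s16 (runs_seq (runs_pop _ _)
    (runs_seq (runs_push _ _ _) (runs_xor_push _ _ _)))) _ _ => //.
  by rewrite s16; store_eq; rewrite /= (negbTE l16).
apply: runs_eq (runs_case_cons Skip s16 (runs_seq (runs_pop _ _)
  (runs_seq (runs_push _ _ _) (runs_push _ _ _)))) _ _ => //.
by rewrite s16; store_eq; rewrite addbF.
Qed.

Lemma runs_pass_next s w p : s 10 = w -> s 16 = [:: p] ->
  runs (for_each 10 (pass_body 10)) s (14 * size w + 1)
    (upd (upd (upd s 10 [::]) 16 [:: p (+) odd (size w)]) 12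
       (rev (xor_next p w) ++ s 12)).
Proof.
elim: w s p => [|b w IH] s p s10 s16.
  by rewrite addbF !upd_idE //; apply: runs_for_nil.
have body := @runs_pass_body 10 (upd s 10 w) b p isT s16.
have := IH _ (~~ p) _ _; set s1 := upd (upd _ _ _) _ _ in body.
move=> /(_ s1 erefl erefl) ex.
apply: runs_eq (runs_for_cons s10 body ex) _ _; last by rewrite /=; lia.
rewrite /s1; store_eq => /=.
by case: p {IH s16 body ex s1}; case: (odd _).
Qed.

Lemma runs_pass_prev (s : store) w p q : s 10 = w -> s 16 = [:: p] ->
  (p -> head false (s 12) = q) ->
  runs (for_each 10 (pass_body 12)) s (14 * size w + 1)
    (upd (upd (upd s 10 [::]) 16 [:: p (+) odd (size w)]) 12
       (rev (xor_prev p q w) ++ s 12)).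
Proof.
elim: w s p q => [|b w IH] s p q s10 s16 hq.
  by rewrite addbF !upd_idE //; apply: runs_for_nil.
have body := @runs_pass_body 12 (upd s 10 w) b p isT s16.
set s1 := upd (upd _ _ _) _ _ in body.
have s1q : p && head false (upd s 10 w 12) = p && q.
  by rewrite /upd /=; case: p hq {IH s16 body s1} => // ->.
have := IH s1 (~~ p) b erefl erefl.
rewrite [s1 12](_ : _ = (b (+) (p && q)) :: s 12); last by rewrite -s1q.
move=> ex; apply: runs_eq (runs_for_cons s10 body (ex _)) _ _.
- by case: (p) => //= _; rewrite addbF.
- rewrite /s1 s1q; store_eq => /=.
  by case: (p); case: (odd _).
by rewrite /=; lia.
Qed.

Lemma runs_generator i s : i < 5 -> s 12 = [::] -> s 16 = [::] ->
  runs (nth Skip generator_cmds i) s (21 * size (s 10) + 5)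
    (upd s 10 (nth id generators i (s 10))).
Proof.
move=> i5 s12 s16.
have next p : runs (pass 10 p) s (21 * size (s 10) + 5) (upd s 10 (xor_next p (s 10))).
  have := @runs_pass_next (upd s 16 [:: p]) _ p erefl erefl.
  have -> : upd s 16 [:: p] 10 = s 10 by [].
  move=> loop.
  have push := runs_push 16 p s; rewrite s16 in push.
  apply: runs_eq (runs_seq push (runs_seq loop (runs_seq (runs_pop _ _)
    (@runs_move _ 12 10 isT)))) _ _; last first.
    by rewrite /upd /= s12 cats0 size_rev size_xor_next; lia.
  by store_eq; rewrite /= ?s12 ?cats0 ?revK.
have prev p : runs (pass 12 p) s (21 * size (s 10) + 5)
    (upd s 10 (xor_prev p false (s 10))).
  have := @runs_pass_prev (upd s 16 [:: p]) _ p false erefl erefl.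
  have -> : upd s 16 [:: p] 10 = s 10 by [].
  have -> : upd s 16 [:: p] 12 = [::] by [].
  move=> /(_ (fun=> erefl)) loop.
  have push := runs_push 16 p s; rewrite s16 in push.
  apply: runs_eq (runs_seq push (runs_seq loop (runs_seq (runs_pop _ _)
    (@runs_move _ 12 10 isT)))) _ _; last first.
    by rewrite /upd /= cats0 size_rev size_xor_prev; lia.
  by store_eq; rewrite /= ?s12 ?cats0 ?revK.
case: i i5 => [|[|[|[|[|i]]]]] //= _.
apply: (@runs_weaken _ _ 5); last by lia.
apply: (@runs_case _ _ _ _ _ 3); case s10 : (s 10) => [|b r] /=.
  by rewrite upd_idE //; exists 0 => //; constructor.
have st := runs_seq (runs_pop 10 s) (runs_push 10 (~~ b) _).
by case: b s10 st => s10 st; apply: runs_eq st _ _ => //; store_eq; rewrite s10.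
Qed.

Definition cond_cmd (c : cmd) : cmd := Case 11 (Seq (Pop 11) c) (Pop 11) Skip.

Definition round_cmd : cmd := foldr (fun c d => Seq (cond_cmd c) d) Skip generator_cmds.

Definition walk_cmd : cmd := While isSome 11 round_cmd.

Lemma runs_cond (c : cmd) g (s : store) b y : s 11 = b :: y ->
  runs c (upd s 11 y) (21 * size (s 10) + 5) (upd (upd s 11 y) 10 (g (s 10))) ->
  runs (cond_cmd c) s (21 * size (s 10) + 8)
    (upd (upd s 11 y) 10 (if b then g (s 10) else s 10)).
Proof.
move=> s11 ex; have pop := runs_pop 11 s; rewrite s11 /= in pop.
apply: (@runs_weaken _ _ (21 * size (s 10) + 6 + 2)); last by lia.
apply: (runs_case_cons Skip s11); case: b {s11}.
  by apply: runs_weaken (runs_seq pop ex) _; lia.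
by apply: runs_eq pop _ _; [store_eq | lia].
Qed.

Lemma runs_round_of cs gs : size cs = size gs ->
  (forall i (s : store), i < size gs -> s 12 = [::] -> s 16 = [::] ->
    runs (nth Skip cs i) s (21 * size (s 10) + 5) (upd s 10 (nth id gs i (s 10)))) ->
  (forall i x, size (nth id gs i x) = size x) ->
  forall s : store, size gs <= size (s 11) -> s 12 = [::] -> s 16 = [::] ->
  runs (foldr (fun c d => Seq (cond_cmd c) d) Skip cs) s
    (size gs * (21 * size (s 10) + 8))
    (upd (upd s 11 (drop (size gs) (s 11))) 10
       (act gs (take (size gs) (s 11)) (s 10))).
Proof.
elim: cs gs => [|c cs IH] [|g gs] //= => [_ _ _ s _ _ _|[szs] ex gS s s11 s12 s16].
  by rewrite drop0 take0 !upd_idE //; apply: runs_skip.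
case e : (s 11) s11 => [|b y] //= sy.
have step := runs_cond e (ex 0 (upd s 11 y) isT s12 s16).
have rest := IH _ szs (fun i s' h => ex i.+1 s' h) (fun i => gS i.+1)
  (upd (upd s 11 y) 10 (if b then g (s 10) else s 10)) sy s12 s16.
apply: runs_eq (runs_seq step rest) _ _; first by store_eq.
rewrite /upd /= -[if b then _ else _]/(if b then nth id (g :: gs) 0 (s 10) else s 10).
by case: b {e step rest}; rewrite ?gS; lia.
Qed.

Lemma runs_round s : 5 <= size (s 11) -> s 12 = [::] -> s 16 = [::] ->
  runs round_cmd s (105 * size (s 10) + 40)
    (upd (upd s 11 (drop 5 (s 11))) 10 (act generators (take 5 (s 11)) (s 10))).
Proof.
move=> s11 s12 s16; apply: runs_weaken.
  by apply: (@runs_round_of generator_cmds generators) => //;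
    [move=> i s'; apply: runs_generator | apply: size_generators].
by rewrite /=; lia.
Qed.

Lemma runs_walk r (s : store) : size (s 11) = 5 * r -> s 12 = [::] -> s 16 = [::] ->
  runs walk_cmd s (r * (105 * size (s 10) + 42) + 1)
    (upd (upd s 11 [::]) 10 (walk r (s 11) (s 10))).
Proof.
elim: r s => [|r IH] s s11 s12 s16.
  have e : s 11 = [::] by apply: size0nil; rewrite s11.
  by rewrite /= -{1}e !upd_id; apply: runs_stop; rewrite e.
have s11' : 5 <= size (s 11) by rewrite s11; lia.
have rnd := runs_round s11' s12 s16.
have := IH (upd (upd s 11 (drop 5 (s 11))) 10 (act generators (take 5 (s 11)) (s 10))).
rewrite {1}/upd [size _]/= size_drop s11 => /(_ _ s12 s16) ex.
apply: runs_eq (runs_loop _ rnd (ex _)) _ _.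
- by case: (s 11) s11'.
- by lia.
- by store_eq.
by rewrite /upd /= size_act; [lia | exact: size_generators].
Qed.

(** * Locating a block *)

(** A single descent to one leaf of the recursion, the index bits choosing halves from the most
    significant on. Recomputing each block from the seed avoids a recursion stack at the price of a
    polynomial factor. *)
Fixpoint block_path (rs : seq nat) (bs w : seq bool) : seq bool :=
  match rs, bs with
  | r :: rs', b :: bs' =>
      block_path rs' bs' (if b then walk r (take (5 * r) w) (drop (5 * r) w)
                    else drop (5 * r) w)
  | _, _ => w
  end.

Lemma value_rcons l b : value (rcons l b) = value l + b * 2 ^ size l.
Proof.
elim: l => [|a l IH] /=; first by rewrite addn0 muln1.
by rewrite IH expnS; lia.
Qed.

Lemma nth_gen rs bs w : size bs = size rs ->
  nth [::] (gen rs w) (value (rev bs)) = block_path rs bs w.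
Proof.
elim: rs bs w => [|r rs IH] [|b bs] w //= [sz].
have lt := value_lt (rev bs); rewrite size_rev sz in lt.
rewrite rev_cons value_rcons size_rev sz nth_cat size_gen.
case: b; first by rewrite mul1n ltnNge leq_addl /= addnK IH.
by rewrite mul0n addn0 lt IH.
Qed.

(** Unary, with [false] as separator; [5 * r] is the number of label bits to cut off the seed at
    that level. *)
Fixpoint schedule_word (rs : seq nat) : seq bool :=
  if rs is r :: rs' then nseq (5 * r) true ++ false :: schedule_word rs' else [::].

Lemma size_schedule_word rs : size (schedule_word rs) = 5 * sumn rs + size rs.
Proof. by elim: rs => //= r rs IH; rewrite size_cat size_nseq /= IH; lia. Qed.

Definition take_label : cmd :=
  Case 10 (Seq (Pop 10) (Push 12 true)) (Seq (Pop 10) (Push 12 false)) Skip.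

Definition level_cmd (b : bool) : cmd :=
  Seq (While (pred1 (Some true)) 8 (Seq (Pop 8) take_label))
  (Seq (Pop 8) (Seq (move 12 11) (if b then walk_cmd else for_each 11 (fun=> Skip)))).

Lemma runs_take_label (s : store) b w : s 10 = b :: w ->
  runs take_label s 5 (upd (upd s 10 w) 12 (b :: s 12)).
Proof.
move=> s10; have ex := runs_seq (runs_pop 10 s) (runs_push 12 b _).
rewrite s10 /= updE_neq // in ex.
apply: (@runs_weaken _ _ (3 + 2)) => //.
by apply: (runs_case_cons Skip s10); case: b ex {s10}.
Qed.

Lemma runs_take_labels (s : store) d sw : s 8 = nseq d true ++ false :: sw ->
  d <= size (s 10) ->
  runs (While (pred1 (Some true)) 8 (Seq (Pop 8) take_label)) s (8 * d + 1)
    (upd (upd (upd s 8 (false :: sw)) 10 (drop d (s 10))) 12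
       (rev (take d (s 10)) ++ s 12)).
Proof.
elim: d s => [|d IH] s s8 sd.
  by rewrite drop0 take0 -[X in upd s 8 X]s8 !upd_id; apply: runs_stop; rewrite s8.
case s10 : (s 10) sd => [|b w] //= sd.
have pop := runs_pop 8 s; rewrite s8 /= in pop.
have body := runs_seq pop (@runs_take_label _ b w _); rewrite {1}/upd /= in body.
have := IH (upd (upd (upd s 8 (nseq d true ++ false :: sw)) 10 w) 12 (b :: s 12)) erefl sd.
move=> ex; apply: runs_eq (runs_loop _ (body s10) ex) _ _; first by rewrite s8.
  by store_eq.
by lia.
Qed.

Lemma runs_clear (s : store) i :
  runs (for_each i (fun=> Skip)) s (5 * size (s i) + 1) (upd s i [::]).
Proof.
move e: (s i) => l; elim: l s e => [|b l IH] s e.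
  by rewrite upd_idE //; apply: runs_for_nil.
have := IH (upd s i l) (updE _ _ _) => ex.
apply: runs_eq (runs_for_cons e (runs_skip _) ex) _ _; first by rewrite upd_upd.
by rewrite /=; lia.
Qed.

Lemma runs_level (s : store) r b sw : s 8 = schedule_word [:: r] ++ sw ->
  5 * r <= size (s 10) -> s 11 = [::] -> s 12 = [::] -> s 16 = [::] ->
  runs (level_cmd b) s (r * (105 * size (s 10) + 117) + 4)
    (upd (upd s 8 sw) 10
       (if b then walk r (take (5 * r) (s 10)) (drop (5 * r) (s 10))
        else drop (5 * r) (s 10))).
Proof.
rewrite /= -catA /= => s8 sr s11 s12 s16.
set x := drop _ _; set y := take _ _.
have sy : size y = 5 * r by rewrite size_takel.
have lab := runs_take_labels s8 sr; rewrite -/x -/y s12 cats0 in lab.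
have pop := runs_pop 8 (upd (upd (upd s 8 (false :: sw)) 10 x) 12 (rev y)).
have {}pop : runs (Pop 8) (upd (upd (upd s 8 (false :: sw)) 10 x) 12 (rev y)) 1
    (upd (upd (upd s 8 sw) 10 x) 12 (rev y)).
  by apply: runs_eq pop _ _ => //; store_eq.
have mv : runs (move 12 11) (upd (upd (upd s 8 sw) 10 x) 12 (rev y)) (7 * (5 * r) + 1)
    (upd (upd (upd s 8 sw) 10 x) 11 y).
  apply: runs_eq (@runs_move _ 12 11 isT) _ _; last by rewrite updE size_rev sy.
  by rewrite updE revK; store_eq; rewrite /= ?s11 ?s12 ?cats0.
have last_step : runs (if b then walk_cmd else for_each 11 (fun=> Skip))
    (upd (upd (upd s 8 sw) 10 x) 11 y) (r * (105 * size (s 10) + 42) + 1)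
    (upd (upd s 8 sw) 10 (if b then walk r y x else x)).
  case: b; last first.
    apply: runs_eq (runs_clear _ _) _ _; first by store_eq.
    by rewrite updE sy; lia.
  apply: runs_eq (@runs_walk r _ _ _ _) _ _ => //; first by store_eq.
  rewrite [X in size X](_ : _ = x) // size_drop leq_add2r leq_mul2l.
  by rewrite leq_add2r leq_mul2l leq_subr !orbT.
apply: runs_weaken (runs_seq lab (runs_seq pop (runs_seq mv last_step))) _; lia.
Qed.

Definition levels_cmd : cmd := for_each 9 level_cmd.

Lemma runs_levels rs bs m (s : store) : s 9 = bs -> s 8 = schedule_word rs ->
  size bs = size rs -> 5 * sumn rs <= size (s 10) <= m ->
  s 11 = [::] -> s 12 = [::] -> s 16 = [::] ->
  runs levels_cmd s (sumn rs * (105 * m + 117) + 9 * size rs + 1)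
    (upd (upd (upd s 9 [::]) 8 [::]) 10 (block_path rs bs (s 10))).
Proof.
elim: rs bs s => [|r rs IH] [|b bs] s //= s9 s8 sz sm s11 s12 s16.
  by rewrite -{1}s9 -{1}s8 !upd_id; apply: runs_weaken (runs_for_nil _ _) _ => //; lia.
have s8' : s 8 = schedule_word [:: r] ++ schedule_word rs by rewrite s8 /= -catA.
have r10 : 5 * r <= size (s 10) by lia.
have body := @runs_level (upd s 9 bs) r b _ s8' r10 s11 s12 s16.
have := IH bs (upd (upd (upd s 9 bs) 8 (schedule_word rs)) 10
  (if b then walk r (take (5 * r) (s 10)) (drop (5 * r) (s 10))
        else drop (5 * r) (s 10))) erefl erefl.
have s' : size (if b then walk r (take (5 * r) (s 10)) (drop (5 * r) (s 10))
        else drop (5 * r) (s 10)) = size (s 10) - 5 * r.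
  by case: (b); rewrite ?size_walk size_drop.
rewrite updE s' => /(_ _ _ s11 s12 s16) ex.
apply: runs_eq (runs_for_cons s9 body (ex _ _)) _ _.
- by case: sz.
- by lia.
- by store_eq.
have -> : upd s 9 bs 10 = s 10 by [].
have : r * (105 * size (s 10) + 117) <= r * (105 * m + 117).
  by rewrite leq_mul2l leq_add2r leq_mul2l; case/andP: sm => _ ->; rewrite !orbT.
by lia.
Qed.

Definition block_cmd : cmd :=
  Seq (copy 4 6 10) (Seq (copy_rev 5 6 9) (Seq (copy 7 6 8)
  (Seq levels_cmd (Seq (move 10 13) (incr 5 9))))).

Lemma size_block_path rs bs w : size bs = size rs ->
  size (block_path rs bs w) = size w - 5 * sumn rs.
Proof.
elim: rs bs w => [|r rs IH] [|b bs] w //= => [_|[sz]]; first by rewrite muln0 subn0.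
by rewrite IH //; case: b; rewrite ?size_walk size_drop; lia.
Qed.

Definition block_time (m h : nat) : nat := 300 * (m + h + 1) ^ 2.

Lemma runs_block rs (s : store) : s 7 = schedule_word rs -> size (s 5) = size rs ->
  5 * sumn rs <= size (s 4) ->
  (forall i, i \in [:: 6; 8; 9; 10; 11; 12; 16] -> s i = [::]) ->
  runs block_cmd s (block_time (size (s 4)) (size rs))
    (upd (upd s 13 (rev (nth [::] (gen rs (s 4)) (value (s 5))) ++ s 13)) 5
       (incr_bits (s 5))).
Proof.
move=> s7 s5 s4 s0.
have s6 : s 6 = [::] by apply: s0. have s8 : s 8 = [::] by apply: s0.
have s9 : s 9 = [::] by apply: s0. have s10 : s 10 = [::] by apply: s0.
have s11 : s 11 = [::] by apply: s0. have s12 : s 12 = [::] by apply: s0.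
have s16 : s 16 = [::] by apply: s0.
have c1 := @runs_copy s 4 6 10 isT isT isT s6; rewrite s10 cats0 in c1.
have c2 := @runs_copy_rev (upd s 10 (s 4)) 5 6 9 isT isT isT s6.
rewrite [upd _ _ _ 9]s9 cats0 in c2.
have c3 := @runs_copy (upd (upd s 10 (s 4)) 9 (rev (s 5))) 7 6 8 isT isT isT s6.
rewrite [upd _ _ _ 8]s8 cats0 [upd _ _ _ 7]s7 in c3.
have sz : size (rev (s 5)) = size rs by rewrite size_rev.
have := @runs_levels rs (rev (s 5)) (size (s 4))
  (upd (upd (upd s 10 (s 4)) 9 (rev (s 5))) 8 (schedule_word rs))
  erefl erefl sz _ s11 s12 s16.
rewrite [upd _ _ _ 10](_ : _ = s 4) // s4 leqnn => /(_ isT) lv.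
rewrite -nth_gen // revK in lv; set w := nth _ _ _ in lv *.
have sw : size w <= size (s 4).
  by rewrite /w -(revK (s 5)) nth_gen // size_block_path // leq_subr.
have mv : runs (move 10 13) (upd (upd (upd (upd (upd (upd s 10 (s 4)) 9 (rev (s 5))) 8
    (schedule_word rs)) 9 [::]) 8 [::]) 10 w) (7 * size (s 4) + 1)
    (upd s 13 (rev w ++ s 13)).
  apply: runs_eq (@runs_move _ 10 13 isT) _ _; last by rewrite updE; lia.
  by rewrite updE; store_eq; rewrite ?s8 ?s9 ?s10.
have inc := @runs_incr (upd s 13 (rev w ++ s 13)) 5 9 isT s9.
apply: runs_weaken (runs_seq c1 (runs_seq c2 (runs_seq c3 (runs_seq lv (runs_seq mv inc))))) _.
rewrite [upd _ _ _ 5](_ : _ = s 5) // [upd _ _ _ 5](_ : _ = s 5) // s5.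
rewrite size_schedule_word /block_time expnS expn1.
have : sumn rs * (105 * size (s 4) + 117) <= size (s 4) * (105 * size (s 4) + 117).
  by rewrite leq_mul2r; apply/orP; right; lia.
move: (sumn rs) (size (s 4)) (size rs) s4; nia.
Qed.

Definition blocks_cmd : cmd := Seq (for_each 15 (fun=> block_cmd)) (move 13 14).

(** The condition on the counter is guarded by [l != [::]] because the increment after the last
    block may overflow its [size rs] digits. *)
Lemma runs_block_loop rs l (s : store) : s 7 = schedule_word rs -> s 15 = l ->
  5 * sumn rs <= size (s 4) ->
  (forall i, i \in [:: 6; 8; 9; 10; 11; 12; 16] -> s i = [::]) ->
  (l != [::] -> size (s 5) = size rs /\ value (s 5) + size l <= 2 ^ size rs) ->
  exists2 s', runs (for_each 15 (fun=> block_cmd)) s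
      (size l * (block_time (size (s 4)) (size rs) + 5) + 1) s' &
    s' 13 = rev (flatten (take (size l) (drop (value (s 5)) (gen rs (s 4))))) ++ s 13
    /\ s' 14 = s 14.
Proof.
elim: l s => [|b l IH] s s7 s15 s4 s0 lh.
  by exists s; [exact: (runs_for_nil _ s15) | rewrite take0].
have [s5 vl] := lh isT; rewrite /= in vl.
have body := @runs_block rs (upd s 15 l) s7 s5 s4 _.
have /body {}body : forall i, i \in [:: 6; 8; 9; 10; 11; 12; 16] -> upd s 15 l i = [::].
  by move=> i i0; rewrite updE_neq ?s0 //; apply: contraTneq i0 => ->.
have vlt : value (s 5) < 2 ^ size rs by lia.
set s1 := upd (upd _ 13 _) 5 _ in body.
have [||s' ex [s'13 s'14]] := IH s1 s7 erefl s4 _ _.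
- by move=> i i0; rewrite /s1 !updE_neq ?s0 //; apply: contraTneq i0 => ->.
- move=> l0; rewrite [s1 5](_ : _ = incr_bits (s 5)) // value_incr; split; last by lia.
  by rewrite size_incr s5 //; case: (l) l0 vl => //= *; lia.
exists s'.
  apply: runs_weaken (runs_for_cons s15 body ex) _.
  by rewrite [s1 4](_ : _ = s 4) // [upd s 15 l 4](_ : _ = s 4) //=; lia.
rewrite s'13 s'14 [s1 5](_ : _ = incr_bits (s 5)) // value_incr; split=> //.
rewrite [s1 4](_ : _ = s 4) // [s1 13](_ : _ =
  rev (nth [::] (gen rs (s 4)) (value (s 5))) ++ s 13) // catA -rev_cat.
by rewrite [in RHS](drop_nth [::]) ?size_gen.
Qed.

Lemma runs_blocks rs k h (s : store) : s 7 = schedule_word rs -> s 15 = nseq k true ->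
  s 5 = nseq h false -> h = size rs -> k <= 2 ^ h ->
  5 * sumn rs <= size (s 4) -> size (s 4) = seed_length (size (s 4) - 5 * sumn rs) rs ->
  (forall i, i \in [:: 6; 8; 9; 10; 11; 12; 13; 14; 16] -> s i = [::]) ->
  exists2 s', runs blocks_cmd s
      (k * (block_time (size (s 4)) h + 5 + 7 * size (s 4)) + 2) s' &
    s' 14 = flatten (take k (gen rs (s 4))).
Proof.
move=> s7 s15 s5 hh kh s4 s4n s0.
have val0 : value (nseq h false) = 0 by elim: (h) => //= ? ->.
have [||s' ex [s'13 s'14]] := runs_block_loop s7 s15 s4 _ _.
- move=> i i0; apply: s0; move: i0; rewrite !inE.
  by repeat case/orP=> [->|]; rewrite ?orbT // => ->; rewrite !orbT.
- by move=> _; rewrite s5 val0 !size_nseq hh -hh.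
rewrite s5 val0 drop0 size_nseq [s 13]s0 ?cats0 // in s'13.
rewrite [s 14]s0 // in s'14.
have mv := @runs_move s' 13 14 isT; rewrite s'13 s'14 revK cats0 in mv.
exists (upd (upd s' 13 [::]) 14 (flatten (take k (gen rs (s 4))))); last exact: updE.
apply: runs_weaken (runs_seq ex mv) _; rewrite size_rev size_nseq -hh.
suff : size (flatten (take k (gen rs (s 4)))) <= k * size (s 4) by lia.
have flat xs : all (fun x => size x == size (s 4) - 5 * sumn rs) xs ->
    size (flatten xs) <= size xs * size (s 4).
  elim: xs => //= x xs IH /andP[/eqP sx /IH]; rewrite size_cat sx; lia.
have := all_size_gen s4n; rewrite -{1}(cat_take_drop k (gen rs (s 4))) all_cat.
case/andP=> /flat /leq_trans + _; apply.
by rewrite leq_mul2r; apply/orP; right; rewrite size_take; case: ltnP.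
Qed.

(** * Setting up the schedule *)

Definition repeat_cmd (m : nat) (c : cmd) : cmd := iter m (Seq c) Skip.

(** Arithmetic on lengths: register [i] contributes its length, times [5 * K], to the schedule and
    is itself stretched by [m]. With [m = 2], register 2 runs through the lengths [2 ^ j * L]; with
    [m = 1], register 3 keeps length [c]. *)
Definition pad_cmd (K i m : nat) : cmd :=
  Seq (for_each i (fun=> Seq (repeat_cmd (5 * K) (Push 7 true))
                             (repeat_cmd m (Push 6 true))))
      (move 6 i).

Definition schedule_cmd (K : nat) : cmd :=
  Seq (Push 7 false) (Seq (pad_cmd K 2 2) (pad_cmd K 3 1)).

Lemma nseq_cons_cat (T : Type) m (b : T) x : nseq m b ++ b :: x = b :: nseq m b ++ x.
Proof. by elim: m => //= m ->. Qed.

Lemma runs_repeat_push m i b (s : store) :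
  runs (repeat_cmd m (Push i b)) s (2 * m) (upd s i (nseq m b ++ s i)).
Proof.
elim: m s => [|m IH] s; first by rewrite upd_id; apply: runs_skip.
apply: runs_eq (runs_seq (runs_push i b s) (IH _)) _ _; last by lia.
by rewrite updE upd_upd nseq_cons_cat.
Qed.

Lemma runs_pad K i m (s : store) : i \notin [:: 6; 7] -> s 6 = [::] ->
  runs (pad_cmd K i m) s ((10 * K + 9 * m + 5) * size (s i) + 2)
    (upd (upd s 7 (nseq (5 * K * size (s i)) true ++ s 7)) i
       (nseq (m * size (s i)) true)).
Proof.
rewrite !inE negb_or => /andP[i6 i7] s6.
have [i6' i7'] : (6 == i) = false /\ (7 == i) = false.
  by rewrite ![_ == i]eq_sym (negbTE i6) (negbTE i7).
have loop l t : t i = l -> runs (for_each i (fun=> Seq (repeat_cmd (5 * K) (Push 7 true))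
      (repeat_cmd m (Push 6 true)))) t ((10 * K + 2 * m + 5) * size l + 1)
    (upd (upd (upd t i [::]) 7 (nseq (5 * K * size l) true ++ t 7)) 6
       (nseq (m * size l) true ++ t 6)).
  elim: l t => [|b l IH] t ti.
    by rewrite /= !muln0 /= !upd_idE //; apply: runs_for_nil.
  have body := runs_seq (runs_repeat_push (5 * K) 7 true (upd t i l))
    (runs_repeat_push m 6 true _).
  set t1 := upd _ 6 _ in body.
  have t1i : t1 i = l by rewrite /t1 /upd (negbTE i6) (negbTE i7) eqxx.
  apply: runs_eq (runs_for_cons ti body (IH _ t1i)) _ _; last by rewrite /=; lia.
  rewrite /t1 /upd /= i6' i7' /= !mulnS ![_ + _ * size l]addnC !nseqD -!catA.
  by store_eq.
apply: runs_eq (runs_seq (loop _ s erefl) (@runs_move _ 6 i _)) _ _.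
- by rewrite eq_sym.
- by rewrite updE s6 cats0 rev_nseq; store_eq; rewrite /= cats0.
by rewrite updE s6 cats0 size_nseq; lia.
Qed.

Lemma runs_schedule K (s : store) : s 6 = [::] ->
  runs (schedule_cmd K) s
    ((10 * K + 30) * (size (s 2) + size (s 3)) + 10)
    (upd (upd (upd s 7 (nseq (5 * (K * (size (s 2) + size (s 3)))) true ++ false :: s 7))
       2 (nseq (2 * size (s 2)) true)) 3 (nseq (size (s 3)) true)).
Proof.
move=> s6; set a := size (s 2); set c := size (s 3).
have push := runs_push 7 false s.
have pad2 := @runs_pad K 2 2 (upd s 7 (false :: s 7)) isT s6.
set s2 := upd _ 2 _ in pad2.
have pad3 := @runs_pad K 3 1 s2 isT s6.
apply: runs_eq (runs_seq push (runs_seq pad2 pad3)) _ _; last first.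
  by rewrite [s2 3](_ : _ = s 3) // [upd s _ _ 2](_ : _ = s 2) // -/a -/c; lia.
rewrite [s2 3](_ : _ = s 3) // /s2 mul1n; store_eq => /=.
by rewrite catA -nseqD -/a -/c (_ : 5 * K * c + 5 * K * a = 5 * (K * (a + c))) //; lia.
Qed.

Definition schedules_cmd (K : nat) : cmd := for_each 8 (fun=> schedule_cmd K).

Lemma runs_schedules K L c j l (s : store) : s 8 = l -> s 6 = [::] ->
  size (s 2) = 2 ^ j * L -> size (s 3) = c -> s 7 = schedule_word (schedule K L c j) ->
  exists2 s', runs (schedules_cmd K) s
      (size l * ((10 * K + 30) * (2 ^ (j + size l) * L + c) + 15) + 1) s' &
    s' 7 = schedule_word (schedule K L c (j + size l)) /\ s' 8 = [::] /\
    forall i, i \notin [:: 2; 3; 7; 8] -> s' i = s i.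
Proof.
elim: l j s => [|b l IH] j s s8 s6 s2 s3 s7.
  rewrite addn0 mul0n; exists s; last by split=> //; split.
  exact: runs_for_nil.
have body := @runs_schedule K (upd s 8 l) s6.
have [e2 e3 e7] : [/\ upd s 8 l 2 = s 2, upd s 8 l 3 = s 3 & upd s 8 l 7 = s 7] by [].
rewrite e2 e3 e7 in body.
rewrite s2 s3 s7 in body.
set s1 := upd (upd _ 2 _) 3 _ in body.
have [|||s' ex [s'7 [s'8 s'i]]] := IH j.+1 s1 erefl s6.
- by rewrite [s1 2](_ : _ = nseq (2 * (2 ^ j * L)) true) // size_nseq expnS mulnA.
- by rewrite [s1 3](_ : _ = nseq c true) // size_nseq.
- by [].
exists s'.
  apply: runs_weaken (runs_for_cons s8 body ex) _; rewrite /= addSnnS.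
  have : 2 ^ j * L <= 2 ^ (j + (size l).+1) * L by rewrite leq_mul2r leq_exp2l // leq_addr orbT.
  nia.
rewrite /= -addSnnS s'7; split=> //; split=> // i ni; rewrite s'i //.
move: ni; rewrite !inE !negb_or => /and4P[n2 n3 n7 n8].
by rewrite /s1 /upd (negbTE n2) (negbTE n3) (negbTE n7) (negbTE n8).
Qed.

(** * The whole program *)

(** The digits of [k.-1], the last block index, obtained by counting as the program does. For
    positive [k] their number is the base-2 logarithm of [k] rounded up. *)
Fixpoint block_index (k : nat) : seq bool :=
  if k is k'.+1 then if k' is 0 then [::] else incr_bits (block_index k') else [::].

Lemma value_block_index k : value (block_index k) = k.-1.
Proof. by elim: k => [|[|k] IH] //; rewrite [block_index _]/(incr_bits _) value_incr IH. Qed.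

Lemma block_index_iter j : block_index j.+1 = iter j incr_bits [::].
Proof. by elim: j => //= j ->. Qed.

Definition height (k : nat) : nat := size (block_index k).

Lemma height_le k : height k <= k.-1.
Proof.
elim: k => [|[|k] IH] //; apply: leq_trans (size_incr_le _) _.
exact: IH.
Qed.

Lemma leq_exp_height k : k <= 2 ^ height k.
Proof. by have := value_lt (block_index k); rewrite value_block_index /height; lia. Qed.

(** Counting up always leaves 1 as top digit, so [2 ^ size l <= 2 * value l] for a nonempty word;
    the empty word is the case [k = 1]. *)
Lemma exp_height_leq k : 0 < k -> 2 ^ height k <= 2 * k.
Proof.
have top l : last true l -> l != [::] -> 2 ^ size l <= 2 * value l.
  elim: l => //= b [|c l] IH lt _; first by move: lt => /= ->.
  have := IH lt isT; rewrite -[(size (c :: l)).+1]/(size (c :: l)).+1 expnS; lia.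
have lastT j : last true (iter j incr_bits [::]).
  elim: j => //= j; move: (iter _ _ _) => l; rewrite /incr_bits.
  rewrite last_cat /=; case: (ltnP (find negb l).+1 (size l)) => h.
    rewrite -{1}(cat_take_drop (find negb l).+1 l) last_cat.
    by case: (drop _ _) (size_drop (find negb l).+1 l) => //= ?; lia.
  by rewrite drop_oversize.
case: k => // k _; rewrite /height block_index_iter.
have := top _ (lastT k); rewrite -block_index_iter value_block_index -[k.+1.-1]/k.
case e : (block_index k.+1) => [|b l]; first by move=> _; apply: (@leq_trans 1); rewrite ?muln_gt0.
by move=> /(_ isT); lia.
Qed.

(** Counting to [k.-1] in register 5 finds the height as a length. The loop over 5 then resets the
    counter to zeros of that length, lengthens register 3 to [c], and puts one mark per level into
    8. *)
Definition prepare_cmd (K : nat) : cmd :=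
  Seq (for_each 1 (fun=> Seq (Push 15 true) (Push 6 true)))
  (Seq (Pop 6)
  (Seq (for_each 6 (fun=> incr 5 9))
  (Seq (for_each 5 (fun=> Seq (Push 9 false) (Seq (Push 3 true) (Push 8 true))))
  (Seq (move 9 5) (schedules_cmd K))))).

Definition zeros_cmd : cmd :=
  for_each 1 (fun=> Seq (for_each 0 (fun=> Seq (Push 6 true) (Push 14 false)))
                        (move 6 0)).

(** Removing one digit of the alphabet size and looking for another detects alphabets with at most
    one symbol. Pushing [true] back restores the length of the word, and only its length is used
    later. *)
Definition main_cmd (K : nat) : cmd :=
  let general := Seq (Push 2 true) (Seq (prepare_cmd K) blocks_cmd) in
  let nonempty := Seq (Pop 2) (Case 2 general general zeros_cmd) in
  Case 1 nonempty nonempty zeros_cmd.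

Lemma runs_zeros (s : store) n k : s 0 = nseq n true -> s 1 = nseq k true ->
  s 6 = [::] ->
  runs zeros_cmd s (k * (16 * n + 7) + 1)
    (upd (upd s 1 [::]) 14 (nseq (n * k) false ++ s 14)).
Proof.
move=> s0 s1 s6; elim: k s s0 s1 s6 => [|k IH] s s0 s1 s6.
  by rewrite muln0 !upd_idE //; apply: runs_for_nil.
have inner m t : t 0 = nseq m true ->
    runs (for_each 0 (fun=> Seq (Push 6 true) (Push 14 false))) t (9 * m + 1)
      (upd (upd (upd t 0 [::]) 6 (nseq m true ++ t 6)) 14 (nseq m false ++ t 14)).
  elim: m t => [|m IHm] t t0; first by rewrite !upd_idE //; apply: runs_for_nil.
  have body := runs_seq (runs_push 6 true (upd t 0 (nseq m true)))
    (runs_push 14 false _).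
  apply: runs_eq (runs_for_cons t0 body (IHm _ _)) _ _ => //; last by lia.
  by store_eq; rewrite /= nseq_cons_cat.
have body : runs (Seq (for_each 0 (fun=> Seq (Push 6 true) (Push 14 false))) (move 6 0))
    (upd s 1 (nseq k true)) (16 * n + 2)
    (upd (upd s 1 (nseq k true)) 14 (nseq n false ++ s 14)).
  apply: runs_eq (runs_seq (@inner n (upd s 1 (nseq k true)) s0) (@runs_move _ 6 0 isT)) _ _.
    by store_eq; rewrite /= ?s6 ?s0 ?cats0 ?rev_nseq.
  by rewrite /upd /= s6 cats0 size_nseq; lia.
apply: runs_eq (runs_for_cons s1 body (IH _ _ _ _)) _ _ => //; last by lia.
by store_eq; rewrite mulnS catA -nseqD addnC.
Qed.

Lemma runs_prepare K k (s : store) : 0 < k -> s 1 = nseq k true ->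
  (forall i, 4 < i -> s i = [::]) ->
  let h := height k in let c := size (s 3) + h in
  exists2 s', runs (prepare_cmd K) s
      (100 * (k + 1) ^ 2 + h * ((10 * K + 30) * (2 ^ h * size (s 2) + c) + 15)) s' &
    [/\ s' 7 = schedule_word (schedule K (size (s 2)) c h), s' 15 = nseq k true,
        s' 5 = nseq h false, s' 4 = s 4 &
        forall i, i \in [:: 6; 8; 9; 10; 11; 12; 13; 14; 16] -> s' i = [::]].
Proof.
move=> k0 s1 s0 h c; rewrite /= in s0 *.
have loop1 m t : t 1 = nseq m true ->
    runs (for_each 1 (fun=> Seq (Push 15 true) (Push 6 true))) t (9 * m + 1)
      (upd (upd (upd t 1 [::]) 15 (nseq m true ++ t 15)) 6 (nseq m true ++ t 6)).
  elim: m t => [|m IH] t t1; first by rewrite !upd_idE //; apply: runs_for_nil.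
  have body := runs_seq (runs_push 15 true (upd t 1 (nseq m true)))
    (runs_push 6 true _).
  apply: runs_eq (runs_for_cons t1 body (IH _ _)) _ _ => //; last by lia.
  by store_eq; rewrite /= nseq_cons_cat.
have loop2 m j t : t 6 = nseq m true -> t 9 = [::] -> t 5 = block_index j.+1 ->
    runs (for_each 6 (fun=> incr 5 9)) t (m * (12 * (j + m) + 11) + 1)
      (upd (upd t 6 [::]) 5 (block_index (j + m).+1)).
  elim: m j t => [|m IH] j t t6 t9 t5.
    by rewrite addn0 !upd_idE //; apply: runs_for_nil.
  have body := @runs_incr (upd t 6 (nseq m true)) 5 9 isT t9.
  have t5' : upd t 6 (nseq m true) 5 = block_index j.+1 := t5.
  rewrite t5' in body.
  apply: runs_eq (runs_for_cons t6 body (IH j.+1 _ _ _ _)) _ _ => //.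
    by rewrite addSnnS; store_eq.
  have : size (block_index j.+1) <= j.
    exact: height_le j.+1.
  by rewrite -[size (block_index j.+1)]/(height j.+1); nia.
have loop3 l t : t 5 = l ->
    runs (for_each 5 (fun=> Seq (Push 9 false) (Seq (Push 3 true) (Push 8 true)))) t
      (11 * size l + 1)
      (upd (upd (upd (upd t 5 [::]) 9 (nseq (size l) false ++ t 9)) 3
         (nseq (size l) true ++ t 3)) 8 (nseq (size l) true ++ t 8)).
  elim: l t => [|b l IH] t t5; first by rewrite /= !upd_idE //; apply: runs_for_nil.
  have body := runs_seq (runs_push 9 false (upd t 5 l))
    (runs_seq (runs_push 3 true _) (runs_push 8 true _)).
  apply: runs_eq (runs_for_cons t5 body (IH _ _)) _ _ => //; last by rewrite /=; lia.
  by store_eq; rewrite /= nseq_cons_cat.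
have l1 := loop1 _ _ s1.
have [s15 s6 s5 s9 s8] : [/\ s 15 = [::], s 6 = [::], s 5 = [::], s 9 = [::] & s 8 = [::]].
  by split; apply: s0.
rewrite s15 s6 !cats0 in l1; set s2 := upd _ 6 _ in l1.
have pop := runs_pop 6 s2.
have {}pop : runs (Pop 6) s2 1 (upd (upd (upd s 1 [::]) 15 (nseq k true)) 6 (nseq k.-1 true)).
  by apply: runs_eq pop _ _ => //; rewrite /s2; store_eq; case: (k) k0.
set s3 := upd _ 6 _ in pop.
have l2 := @loop2 k.-1 0 s3 erefl s9 s5; rewrite add0n prednK // in l2.
set s4 := upd _ 5 _ in l2.
have l3 := @loop3 _ s4 erefl.
rewrite [s4 5](_ : _ = block_index k) // -/(height k) -/h in l3.
rewrite [s4 9]s9 [s4 8]s8 !cats0 [s4 3](_ : _ = s 3) // in l3.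
set s5' := upd _ 8 _ in l3.
have mv := @runs_move s5' 9 5 isT.
rewrite [s5' 9](_ : _ = nseq h false) // [s5' 5](_ : _ = [::]) // cats0 rev_nseq in mv.
set s6' := upd _ 5 _ in mv.
have [|||||s7 sch [s77 [s78 s7i]]] := @runs_schedules K (size (s 2)) c 0 (nseq h true) s6'.
- by [].
- by [].
- by rewrite mul1n.
- by rewrite [s6' 3](_ : _ = nseq h true ++ s 3) // size_cat size_nseq addnC.
- exact: (s0 7).
exists s7.
  apply: runs_weaken (runs_seq l1 (runs_seq pop (runs_seq l2 (runs_seq l3 (runs_seq mv sch))))) _.
  rewrite !size_nseq !add0n; have := height_le k; rewrite -/h => hk.
  by rewrite expnS expn1; nia.
rewrite size_nseq add0n in s77; split=> //.
- by rewrite s7i.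
- by rewrite s7i.
- by rewrite s7i.
move=> i; rewrite !inE.
by do ?[case/orP]; move/eqP->; rewrite ?s78 // s7i // /s6' /s5' /s4 /s3 /upd /= ?s0.
Qed.

Definition program_time (K n k L c h m : nat) : nat :=
  k * (16 * n + 7) + 100 * (k + 1) ^ 2 +
  h * ((10 * K + 30) * (2 ^ h * L + c) + 15) +
  k * (block_time m h + 5 + 7 * m) + 12.

Lemma runs_main_zeros K n k sg gm u : k = 0 \/ size sg <= 1 ->
  exists2 s', runs (main_cmd K) (nth [::] [:: nseq n true; nseq k true; sg; gm; u])
      (k * (16 * n + 7) + 12) s' &
    s' 14 = nseq (n * k) false.
Proof.
set s0 := nth _ _ => hk; have s14 : s0 14 = [::] by [].
case: k @s0 s14 hk => [|k] s0 s14 hk.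
  have z := @runs_zeros s0 n 0 erefl erefl erefl.
  exists (upd (upd s0 1 [::]) 14 (nseq (n * 0) false ++ s0 14)); last by rewrite updE cats0.
  by apply: runs_weaken; [apply: runs_case; apply: z | lia].
case: hk => // ssg.
have z := @runs_zeros (upd s0 2 [::]) n k.+1 erefl erefl erefl.
exists (upd (upd (upd s0 2 [::]) 1 [::]) 14 (nseq (n * k.+1) false ++ [::])).
  apply: (@runs_weaken _ _ (1 + (k.+1 * (16 * n + 7) + 1 + 2) + 2)); last by lia.
  apply: (@runs_case_cons 1 _ _ zeros_cmd s0 true (nseq k true)) => //.
  apply: runs_seq (runs_pop _ _) _.
  have -> : behead (s0 2) = [::] by case: (sg) ssg @s0 {s14 z} => [|x [|y sg']].
  exact: runs_case.
by rewrite updE cats0.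
Qed.

Lemma runs_main K n k sg gm u (h := height k) (c := size gm + h)
    (rs := schedule K (size sg) c h) :
  0 < k -> 1 < size sg -> size u = seed_length n rs ->
  exists2 s', runs (main_cmd K) (nth [::] [:: nseq n true; nseq k true; sg; gm; u])
      (program_time K n k (size sg) c h (size u)) s' &
    s' 14 = take (n * k) (flatten (gen rs u)).
Proof.
move=> k0 ssg su; set s0 := nth _ _.
case: sg @rs ssg su @s0 => [|b0 [|b1 sg]] // rs _ su s0.
pose s1 := upd s0 2 [:: true, b1 & sg].
have s1i i : 4 < i -> s1 i = [::].
  by move=> i4; rewrite /s1 /upd /s0 nth_default //; case: eqP i4 => // ->.
have [s2 prep [s27 s215 s25 s24 s2i]] := @runs_prepare K k s1 k0 erefl s1i.
rewrite [s1 2](_ : _ = [:: true, b1 & sg]) // in prep s27.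
rewrite [s1 3](_ : _ = gm) // -/h -/c in prep s27.
rewrite [size _](_ : _ = size [:: b0, b1 & sg]) // in prep s27.
have hrs : h = size rs by rewrite size_schedule.
have s24' : s2 4 = u by rewrite s24.
have szu : size (s2 4) - 5 * sumn rs = n by rewrite s24' su /seed_length addKn.
have [||s3 blk s314] := runs_blocks s27 s215 s25 hrs (leq_exp_height k) _ _ s2i.
- by rewrite s24' su leq_addr.
- by rewrite szu s24' su.
exists s3; last first.
  rewrite s314 s24'.
  have := all_size_gen su; have : k <= size (gen rs u).
    by rewrite size_gen -hrs leq_exp_height.
  elim: (k) (gen rs u) => [|k' IH] [|x xs] //= => [_ _|sk /andP[/eqP sx sxs]].
    by rewrite muln0 take0.
  by rewrite mulnS take_cat sx ltnNge leq_addr /= addKn IH.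
have push : runs (Push 2 true) (upd s0 2 (b1 :: sg)) 2 s1.
  by apply: runs_eq (runs_push _ _ _) _ _ => //; rewrite updE upd_upd.
have general := runs_seq push (runs_seq prep blk).
have s0k : s0 1 = true :: nseq k.-1 true by rewrite /s0 /=; case: (k) k0.
apply: runs_weaken.
  apply: (@runs_case_cons 1 _ _ zeros_cmd s0 true (nseq k.-1 true) _ _ s0k).
  apply: runs_seq (runs_pop _ _) (runs_case _); rewrite /=.
  by case: (b1) general => general; exact: general.
by rewrite s24' /program_time -/h; lia.
Qed.

Lemma main_cmd_regs K : regs_below 17 (main_cmd K).
Proof.
have rep m : regs_below 17 (repeat_cmd m (Push 7 true)) by elim: m.
by rewrite /= !rep.
Qed.

Local Open Scope ring_scope.

(** * Seed length and running time *)

Lemma size_binary m : size (binary m) = up_log 2 m.+1.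
Proof. by rewrite size_mkseq. Qed.

Lemma ltn_exp_binary m : (m < 2 ^ size (binary m))%N.
Proof. by rewrite size_binary up_logP. Qed.

Lemma exp_binary_leq m : (0 < m)%N -> (2 ^ (size (binary m)).-1 <= m)%N.
Proof. by move=> m0; rewrite size_binary -ltnS up_log_gtn. Qed.

Lemma ln2_gt0 (R : realType) : 0 < ln 2 :> R.
Proof. by rewrite ln_gt0 // (ltr_nat R 1 2). Qed.

Lemma log2_exp (R : realType) a : log2 ((2 ^ a)%:R : R) = a%:R.
Proof.
by rewrite /log2 natrX lnXn ?ltr0n // mulrnAl divff ?gt_eqF ?ln2_gt0.
Qed.

Lemma log2_le (R : realType) (x y : R) : 0 < x -> x <= y -> log2 x <= log2 y.
Proof.
move=> x0 xy; rewrite /log2 ler_pM2r ?invr_gt0 ?ln2_gt0 // ler_ln ?posrE //.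
exact: lt_le_trans xy.
Qed.

Lemma le_log2 (R : realType) a (x : R) : (2 ^ a)%:R <= x -> a%:R <= log2 x.
Proof. by move=> ax; rewrite -log2_exp log2_le // ltr0n expn_gt0. Qed.

Lemma log2_nat_ge0 (R : realType) m : 0 <= log2 (m%:R : R).
Proof.
case: m => [|m]; first by rewrite /log2 ln0 ?mul0r.
by apply: (@le_log2 R 0); rewrite ler_nat.
Qed.

Lemma log2_inv_ge0 (R : realType) (gamma : R) : 0 <= log2_inv gamma.
Proof. by rewrite /log2_inv le_max lexx. Qed.

Lemma size_binary_le (R : realType) m :
  (size (binary m))%:R <= 1 + log2 (m%:R : R).
Proof.
have m0 := @log2_nat_ge0 R m.
case: m m0 => [|m] m0; first by rewrite size_binary up_log1; lra.
have := @le_log2 R (size (binary m.+1)).-1 m.+1%:R.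
rewrite ler_nat exp_binary_leq // => /(_ isT).
case: (size _) => [|a] /=; first by lra.
by rewrite -natr1; lra.
Qed.

(** If [gamma^-1] is at least 1, rounding up at most doubles it and costs one more digit; otherwise
    the ceiling is at most 1. *)
Lemma size_ceil_inv_le (R : realType) (gamma : R) : 0 < gamma ->
  (size (binary `|Num.ceil gamma^-1|%N))%:R <= 2 + log2_inv gamma.
Proof.
move=> g0; have i0 : 0 < gamma^-1 by rewrite invr_gt0.
set a := `|_|%N; set G := size _.
have aE : a%:R = (Num.ceil gamma^-1)%:~R :> R.
  by rewrite /a pmulrn gez0_abs // ceil_ge0; lra.
have := ceil_itv gamma^-1; rewrite intrD mulrNz -aE => /andP[a1 _].
have [g1 | g1] := leP 1 (gamma^-1).
  have : log2 gamma^-1 <= log2_inv gamma by rewrite /log2_inv le_max lexx orbT.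
  have a0 : (0 < a)%N by rewrite -(ltr_nat R) aE; have := ceil_ge gamma^-1; lra.
  have := exp_binary_leq a0; rewrite -/G.
  case: G => [|G]; rewrite /= => hG.
    have := log2_inv_ge0 gamma; lra.
  case: G hG => [|G] hG; first by have := log2_inv_ge0 gamma; lra.
  suff /le_log2 : (2 ^ G)%:R <= gamma^-1 by rewrite -!natr1; lra.
  by move: hG; rewrite expnS -(ler_nat R) natrM; lra.
have : (a <= 1)%N by rewrite -ltnS -(ltr_nat R); lra.
have := log2_inv_ge0 gamma; rewrite /G size_binary.
case: a {aE a1 G} => [|[|a]] // h _.
  by rewrite up_log1; lra.
by rewrite up_lognn //; lra.
Qed.

Lemma ler_inv_exp_ceil (R : realType) (gamma : R) : 0 < gamma ->
  (2 ^ size (binary `|Num.ceil gamma^-1|%N))%:R^-1 <= gamma.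
Proof.
move=> g0; have i0 : 0 < gamma^-1 by rewrite invr_gt0.
rewrite -[leRHS]invrK lef_pV2 ?posrE ?ltr0n ?expn_gt0 //.
set a := `|_|%N.
have aE : a%:R = (Num.ceil gamma^-1)%:~R :> R.
  by rewrite /a pmulrn gez0_abs // ceil_ge0; lra.
apply: le_trans (ceil_ge _) _; rewrite -aE ler_nat.
exact/ltnW/ltn_exp_binary.
Qed.

Lemma sumn_schedule_le K L c h :
  (sumn (schedule K L c h) <= K * (2 ^ h * L + h * c))%N.
Proof.
elim: h => //= h IH.
apply: leq_trans (leq_add (leqnn _) IH) _.
by rewrite expnS; move: (2 ^ h)%N => p; nia.
Qed.

Lemma sqr_leq_exp h : (h ^ 2 <= 2 * 2 ^ h)%N.
Proof.
elim: h => // h IH; have := ltn_expl h (ltnSn 1).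
by move: IH; rewrite !expnS expn0; lia.
Qed.

(** Since [c] contains [h], the levels contribute [h ^ 2], at most 4 k by [sqr_leq_exp]. Terms
    linear in [k] are absorbed because an alphabet with two symbols has [log2] at least 1. The 60 is
    5 label bits per step times a generous 12. *)
Lemma seed_length_le (R : realType) (K n k N : nat) (gamma : R)
    (L := size (binary N)) (h := height k)
    (c := (size (binary `|Num.ceil gamma^-1|%N) + h)%N) :
  0 < gamma -> (0 < k)%N -> (1 < N)%N ->
  (seed_length n (schedule K L c h))%:R <=
  n%:R + (60 * K)%:R * (k%:R * log2 (N%:R : R) + log2 (k%:R : R) * log2_inv gamma).
Proof.
move=> g0 k0 N1; rewrite /seed_length natrD addrC lerD2l.
have Lle : L%:R <= 1 + log2 (N%:R : R) := @size_binary_le R N.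
have Gle := size_ceil_inv_le g0; set G := size _ in c Gle *.
have l1 : 1 <= log2 (N%:R : R) by apply: (@le_log2 R 1); rewrite ler_nat.
have li0 := log2_inv_ge0 gamma; have lk0 := @log2_nat_ge0 R k.
have hle : h%:R <= 2 * log2 (k%:R : R).
  rewrite /h; case: (k) k0 => [|[|j]] // _.
    by rewrite mulr_ge0 // log2_nat_ge0.
  have j1 : 1 <= log2 (j.+2%:R : R) by apply: (@le_log2 R 1); rewrite ler_nat.
  suff : (height j.+2)%:R <= 1 + log2 (j.+2%:R : R) by lra.
  have := @exp_height_leq j.+2 isT; case: (height _) => [|a] pa; first by lra.
  rewrite -natr1 addrC lerD2l; apply: le_log2.
  by rewrite ler_nat; move: pa; rewrite expnS leq_mul2l.
have ph := exp_height_leq k0; have hk := height_le k; have sq := sqr_leq_exp h.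
rewrite -/h in ph hk.
have : (5 * sumn (schedule K L c h) <= 5 * (K * (2 * k * L + h * G + 4 * k)))%N.
  rewrite leq_mul2l /=; apply: leq_trans (sumn_schedule_le _ _ _ _) _.
  rewrite leq_mul2l; apply/orP; right; rewrite /c mulnDr mulnn.
  by have := leq_mul ph (leqnn L); lia.
rewrite -(ler_nat R) => /le_trans; apply.
rewrite !natrM !natrD !natrM.
have k1 : 1 <= k%:R :> R by rewrite ler1n.
have hk' : h%:R <= k%:R :> R by rewrite ler_nat; lia.
have K0 : 0 <= K%:R :> R by [].
have e1 : k%:R * L%:R <= k%:R * (2 * log2 (N%:R : R)).
  by rewrite ler_pM2l ?ltr0n //; lra.
have e2 : h%:R * G%:R <= 2 * k%:R + 2 * log2 k%:R * log2_inv gamma :> R.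
  have : h%:R * G%:R <= h%:R * (2 + log2_inv gamma) by rewrite ler_wpM2l.
  have : h%:R * log2_inv gamma <= 2 * log2 k%:R * log2_inv gamma by rewrite ler_wpM2r.
  by rewrite mulrDr; lra.
have e3 : k%:R <= k%:R * log2 N%:R :> R by rewrite ler_peMr.
have e4 : 0 <= log2 (k%:R : R) * log2_inv gamma by rewrite mulr_ge0.
rewrite mulrA [X in _ <= X](_ : _ = 5 * K%:R *
  (12 * (k%:R * log2 N%:R + log2 k%:R * log2_inv gamma))); last by ring.
rewrite ler_wpM2l ?mulr_ge0 //; lra.
Qed.

(** Degree 5: each of the [k] blocks takes time quadratic in the seed length, which is itself
    quadratic in [Z] because of the product [2 ^ h * L]. *)
Lemma program_time_poly K : exists A : nat, forall n k L G : nat,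
  let Z := (1 + n + k + L + G)%N in let h := height k in let c := (G + h)%N in
  (k * (16 * n + 7) + 12 <= A * Z ^ 5)%N /\
  ((0 < k)%N -> (program_time K n k L c h (seed_length n (schedule K L c h))
    <= A * Z ^ 5)%N).
Proof.
pose B := (20 * K + 4)%N.
exists (2000 * B ^ 2)%N => n k L G Z h c.
have Z1 : (1 <= Z)%N by rewrite /Z; lia.
have [Z12 Z23 Z34 Z45] : [/\ Z <= Z ^ 2, Z ^ 2 <= Z ^ 3, Z ^ 3 <= Z ^ 4 & Z ^ 4 <= Z ^ 5]%N.
  by split; [rewrite -{1}(expn1 Z)| | |]; rewrite leq_pexp2l.
have B4 : (4 <= B)%N by rewrite /B; lia.
have BB : (4 * B <= B ^ 2)%N by rewrite expnS expn1 leq_mul2r B4 orbT.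
have AZ a : (a <= 2000 * B ^ 2)%N -> (a * Z ^ 5 <= 2000 * B ^ 2 * Z ^ 5)%N.
  by move=> h'; rewrite leq_mul2r h' orbT.
have zeros : (k * (16 * n + 7) <= 23 * Z ^ 2)%N.
  by rewrite expnS expn1 /Z; nia.
split; first by apply: leq_trans (AZ 35 _); lia.
move=> k0; have := exp_height_leq k0; rewrite -/h => ph.
have hk : (h <= k)%N by have := height_le k; rewrite -/h; lia.
have cZ : (c <= Z)%N by rewrite /c /Z; lia.
have pL : (2 ^ h * L <= 2 * Z ^ 2)%N.
  apply: leq_trans (leq_mul ph (leqnn L)) _.
  by rewrite expnS expn1 -mulnA leq_mul2l leq_mul //= /Z; lia.
have hc : (h * c <= Z ^ 2)%N by rewrite expnS expn1 leq_mul // /Z; lia.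
set m := seed_length _ _.
have mZ : (m + h + 1 <= B * Z ^ 2)%N.
  have := sumn_schedule_le K L c h.
  have : (K * (2 ^ h * L + h * c) <= K * (3 * Z ^ 2))%N by rewrite leq_mul2l; apply/orP; right; lia.
  have : (n + h + 1 <= Z)%N by rewrite /Z; lia.
  by rewrite /m /seed_length /B; lia.
have bt : (block_time m h <= 300 * (B ^ 2 * Z ^ 4))%N.
  rewrite /block_time leq_mul2l /=.
  have -> : (B ^ 2 * Z ^ 4 = (B * Z ^ 2) ^ 2)%N by rewrite expnMn -expnM.
  by rewrite leq_exp2r.
have kZ : (k <= Z)%N by rewrite /Z; lia.
have t1 : (100 * (k + 1) ^ 2 <= 100 * Z ^ 2)%N.
  by rewrite leq_mul2l leq_exp2r // /Z; lia.
have t2 : (h * ((10 * K + 30) * (2 ^ h * L + c) + 15) <= 8 * B * 3 * Z ^ 3 + 15 * Z)%N.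
  apply: (@leq_trans (Z * (8 * B * (3 * Z ^ 2) + 15))); last by rewrite expnS; lia.
  apply: leq_mul; first by lia.
  rewrite leq_add2r leq_mul //; [by rewrite /B; lia | lia].
have t3 : (k * (block_time m h + 5 + 7 * m) <= 300 * (B ^ 2 * Z ^ 5) + 5 * Z + 7 * (B * Z ^ 3))%N.
  apply: (@leq_trans (Z * (300 * (B ^ 2 * Z ^ 4) + 5 + 7 * (B * Z ^ 2)))).
    by apply: leq_mul => //; lia.
  by rewrite [in X in (_ <= X)%N](expnS _ 4) (expnS _ 2); lia.
have BZ3 : (B * Z ^ 3 <= B ^ 2 * Z ^ 5)%N by apply: leq_mul; lia.
have B1 : (Z ^ 5 <= B ^ 2 * Z ^ 5)%N by rewrite leq_pmull //; lia.
rewrite /program_time; lia.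
Qed.

Lemma tree_walk_det n (Sigma : finType) k (T : block_tree n Sigma k) (Xs Ys : seq (bits n)) :
  k = 0%N \/ (#|Sigma| <= 1)%N -> size Xs = k -> size Ys = k ->
  tree_walk T Xs = tree_walk T Ys.
Proof.
move=> [k0|/card_le1P S1]; first by subst k; case: Xs Ys => // -[].
elim: T Xs Ys => [|h v child IH] [|X Xs] [|Y Ys] //= [sX] [sY].
have -> : v X = v Y by have := S1 (v Y) isT (v X); rewrite !inE => /esym/eqP.
by rewrite (IH _ Xs Ys).
Qed.

Theorem theorem3p2 (R : realType) :
  exists (C c : nat) (M : turing_machine),
  forall (n k : nat) (Sigma : finType) (gamma : R), 0 < gamma ->
  exists (s : nat) (Gen : bits s -> bits (n * k)),
    [/\ block_prg gamma Sigma Gen,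
        s%:R <= n%:R + C%:R * (k%:R * log2 (#|Sigma|%:R : R)
                               + log2 (k%:R : R) * log2_inv gamma) &
        forall u : bits s, exists2 t : nat,
          t%:R <= c%:R * (1 + n%:R + k%:R + log2 (#|Sigma|%:R : R)
                          + log2_inv gamma) ^+ c &
          tm_computes_in M (prg_input n k #|Sigma| gamma u) (Gen u) t].
Proof.
have [K hK] := decay_rate R; have [A hA] := program_time_poly K.
(* One number serves as coefficient and as exponent. With X the base in the time bound, the two word
   lengths exceed their logarithms by at most 3 in all, so Z <= 4 X; and X >= 1 lets the exponent
   grow. *)
exists (60 * K)%N, (A * 4 ^ 5 + 5)%N, (machine (inord 14 : 'I_17) (code (main_cmd K) 0)).
move=> n k Sigma gamma g0.
set N := #|Sigma|; set L := size (binary N).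
set gm := binary `|Num.ceil gamma^-1|%N; set G := size gm.
have lN := @log2_nat_ge0 R N; have lk := @log2_nat_ge0 R k.
have li := log2_inv_ge0 gamma.
have [tz tg] := hA n k L G.
have time t : (t <= A * (1 + n + k + L + G) ^ 5)%N ->
    t%:R <= (A * 4 ^ 5 + 5)%:R * (1 + n%:R + k%:R + log2 (N%:R : R)
                          + log2_inv gamma) ^+ (A * 4 ^ 5 + 5).
  set X := 1 + _ + _ + _ + _.
  have X1 : 1 <= X by rewrite /X; have := ler0n R n; have := ler0n R k; lra.
  have ZX : (1 + n + k + L + G)%:R <= 4 * X.
    rewrite !natrD /X; have := size_binary_le R N; have := size_ceil_inv_le g0.
    rewrite -/gm -/G -/L; have := ler0n R n; have := ler0n R k; lra.
  rewrite -(ler_nat R) => /le_trans; apply.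
  rewrite natrM natrX.
  apply: (@le_trans _ _ (A%:R * (4 * X) ^+ 5)).
    by rewrite ler_wpM2l // lerXn2r // nnegrE //; lra.
  rewrite exprMn mulrA; apply: ler_pM.
  - by rewrite mulr_ge0 // exprn_ge0.
  - by rewrite exprn_ge0 //; lra.
  - by rewrite -natrX -natrM ler_nat leq_addr.
  by rewrite ler_weXn2l // leq_addl.
have out14 : nat_of_ord (inord 14 : 'I_17) = 14%N by rewrite inordK.
(* Here [k * log2 #|Sigma|] vanishes and can absorb no additive constants. But every tree then has a
   single possible walk, so an empty seed and a constant output suffice. *)
case: (boolP ((k == 0%N) || (L <= 1)%N)) => [triv|].
  have {triv} triv : k = 0%N \/ (L <= 1)%N by case/orP: triv => [/eqP|]; [left|right].
  have sG : size (nseq (n * k) false) == (n * k)%N by rewrite size_nseq.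
  exists 0%N, (fun=> Tuple sG); split.
  - move=> T; rewrite (_ : tv_dist _ _ = 0) ?ltW //.
    apply: tv_dist_refl => [||u x]; rewrite ?card_tuple ?expn_gt0 ?card_bool //.
    apply: val_inj; apply: tree_walk_det; rewrite ?size_tuple //.
    case: triv => [->|L1]; [by left | right].
    have := ltn_exp_binary N; rewrite -/L -/N; case: (L) L1 => [|[|l]] //=.
    by move=> _; rewrite expn0; case: (N).
  - by rewrite addr_ge0 // mulr_ge0 // addr_ge0 // mulr_ge0.
  move=> u; have [s' [t tT ex] s'14] := runs_main_zeros K n gm (val u) triv.
  exists t; first by apply: time; apply: leq_trans tT tz.
  have := exec_computes (inord 14) (main_cmd_regs K) ex.
  by rewrite out14 s'14.
rewrite negb_or -lt0n -ltnNge => /andP[k0 L1].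
have N1 : (1 < N)%N.
  rewrite ltnNge; apply: contraL L1 => N1; rewrite -leqNgt /L size_binary.
  by case: (N) N1 => [|[|?]] // _; rewrite ?up_log1 ?up_lognn.
set h := height k; set c := (G + h)%N; set rs := schedule K L c h.
have sg (u : bits (seed_length n rs)) :
    size (take (n * k) (flatten (gen rs u))) == (n * k)%N.
  rewrite size_takel // (@size_flatten_gen n) ?size_tuple // size_schedule.
  by rewrite leq_mul2l leq_exp_height orbT.
exists (seed_length n rs), (fun u => Tuple (sg u)); split.
- apply: (gen_block_prg hK) => //.
  + exact/ltnW/ltn_exp_binary.
  + exact: ltnW.
  + exact: leq_exp_height.
  (* The [h] in [c] cancels the doubling of errors, leaving 2^-G, which is at most [gamma]. *)
  have p0 : (2 ^ h)%:R != 0 :> R by rewrite pnatr_eq0 expn_eq0.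
  rewrite /c expnD natrM invfM mulrCA divff // mulr1.
  exact: ler_inv_exp_ceil.
- exact: seed_length_le.
move=> u.
have su : size u = seed_length n rs by rewrite size_tuple.
have [s' [t tT ex] s'14] := runs_main (K := K) k0 L1 su.
exists t; first by apply: time; apply: leq_trans tT _; rewrite su; apply: tg.
have := exec_computes (inord 14) (main_cmd_regs K) ex.
by rewrite out14 s'14.
Qed.
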